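(* Let $0<a<1$ be fixed, and let $X(a)=[-1,-a]\cup[a,1]$. For each positive integer $m$ let $p_m$ be the (unique) polynomial of degree at most $2m+1$ of least uniform deviation from $\operatorname{sgn}(x)$ on $X(a)$, and let $L_m(a)=\max_{x\in X(a)}|p_m(x)-\operatorname{sgn}(x)|$. Then the following limit exists and has the indicated value: $$\lim_{m\to\infty}\sqrt{m}\left(\frac{1+a}{1-a}\right)^{m}L_m(a)=\frac{1-a}{\sqrt{\pi a}}.$$
   Context: $\operatorname{sgn}(x)=1$ for $x>0$, $\operatorname{sgn}(x)=-1$ for $x<0$. The polynomial $p_m$ minimizes $\max_{X(a)}|p-\operatorname{sgn}|$ over all polynomials $p$ of degree at most $2m+1$; by Chebyshev's theory it exists and is unique, so $L_m(a)$ is the error of best uniform approximation of $\operatorname{sgn}$ on $X(a)$ by polynomials of degree at most $2m+1$. *)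

(* Defs.v *)
From mathcomp Require Import all_boot all_order all_algebra.
From mathcomp Require Import all_classical all_reals all_analysis.
Import Order.TTheory GRing.Theory Num.Theory numFieldNormedType.Exports.

Set Implicit Arguments.
Unset Strict Implicit.
Unset Printing Implicit Defensive.

Local Open Scope classical_set_scope.
Local Open Scope ring_scope.

Definition X_set (R : realType) (a : R) : set R :=
  [set` `[-1, - a]] `|` [set` `[a, 1]].

(* For 0 < a < 1 the set is nonempty and compact and avoids 0, so this supremum
   is a maximum and the convention Num.sg 0 = 0 plays no role. *)
Definition deviation (R : realType) (a : R) (p : {poly R}) : R :=
  sup [set `|p.[x] - Num.sg x| | x in X_set a].

(* size p = deg p + 1 for p != 0, so size p <= n.+1 means deg p <= n. *)
Definition best_approx (R : realType) (a : R) (n : nat) (p : {poly R}) : Prop :=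
  (size p <= n.+1)%N /\
  forall q : {poly R}, (size q <= n.+1)%N -> deviation a p <= deviation a q.

(* Main.v *)
Require Import Defs.
From mathcomp Require Import all_boot all_order all_algebra.
From mathcomp Require Import all_classical all_reals all_analysis.
From mathcomp Require Import complex ring lra zify.
Import Order.TTheory GRing.Theory Num.Theory numFieldNormedType.Exports.

(** Put [rho = (1 - a) / (1 + a)] and [z = exp (i th)].  The points of [[a, 1]]
    are exactly the numbers [x = (1 + a) / 2 * |1 + rho z|], and [x ^ 2] is affine
    in [cos th], so an odd polynomial of degree at most [2m + 1] in [x] is
    [|1 + rho z|] times a cosine polynomial of degree at most [m] in [th].
    Approximating [sgn] by odd polynomials therefore means approximating
    [1 / |1 + rho z|] by cosine polynomials with the weight [|1 + rho z|].

    The function to be approximated is the square modulus of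
    [(1 + rho z) ^ (-1/2) = sum_j b_j (- rho z) ^ j], where
    [b_j = C(2j, j) / 4 ^ j].  Its Laurent coefficient of index [k] is
    [(- rho) ^ k * sum_j b_j b_(j + k) rho ^ (2 j)].  Cut the expansion at [|k| <= m].
    Since [b] varies slowly, all factors [b_(j + k)] in the remainder may be frozen
    to [b_(m + 1)] at a relative cost [O(1 / m)]; what is left sums to
    [2 b_(m + 1) S Re ((- rho z) ^ (m + 1) / (1 + rho z))] with
    [S = sum_j b_j rho ^ (2 j) = (1 - rho ^ 2) ^ (-1/2)].  Multiplied by the weight, this
    is a pure oscillation, of constant amplitude
    [A_m = 2 b_(m + 1) S rho ^ (m + 1)] and of phase
    [(m + 1) th - arg (1 + rho z)] ([truncation_estimate],
    [truncated_sum_estimate]).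

    Hence the truncation is nearly optimal.  Its deviation bounds the error from
    above by [A_m (1 + O(1 / m))] ([deviation_le_amplitude]).  Conversely the phase goes
    from [0] to [(m + 1) pi] on [[0, pi]], so the error of the truncation alternates at
    [m + 2] points of [[a, 1]].  A polynomial [q] doing much better would make
    the odd part of its difference with the truncation alternate too, hence vanish at
    [m + 1] positive points and their opposites, which is too many
    ([odd_alternation], [deviation_ge_amplitude]).  So the best deviation is
    [A_m (1 + O(1 / m))], and the Wallis bounds [b_m ~ 1 / sqrt (pi m)]
    ([cbin_wallis]) turn this into the stated limit.

    In the truncation argument the series are replaced by partial sums with [M]
    terms beyond the cut: every error due to [M] is [O(rho ^ M)], uniformly in
    [th], and [M] is chosen last.

    Existence of a best approximation is compactness, in the coordinates given by
    the values at [n + 1] nodes ([best_approx_exists]).  For uniqueness, the mean of two best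
    approximations is again best, and the two agree wherever their mean
    attains its deviation.  A best approximation of positive deviation attains
    it at more than [n + 1] points, since otherwise it is improved by subtracting a small
    multiple of a polynomial interpolating the error there
    ([few_extremal_points]). *)

Set Implicit Arguments.
Unset Strict Implicit.
Unset Printing Implicit Defensive.

Local Open Scope classical_set_scope.
Local Open Scope ring_scope.

(** * Existence and uniqueness of the best approximation *)

Section Interpolation.
Variable F : fieldType.

Lemma poly_interpolation (s : seq F) (f : F -> F) : uniq s ->
  exists2 r : {poly F}, (size r <= size s)%N & {in s, forall x, r.[x] = f x}.
Proof.
elim: s => [|y s IH] /=; first by exists 0; rewrite ?size_poly0.
case/andP=> ys us; have [r rs hr] := IH us.
pose g : {poly F} := \prod_(z <- s) ('X - z%:P).
have gy : g.[y] != 0.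
  by rewrite -[_ == 0]/(root g y) root_prod_XsubC.
exists (r + ((f y - r.[y]) / g.[y]) *: g).
  rewrite (leq_trans (size_polyD _ _))// geq_max (leq_trans rs)//=.
  by rewrite (leq_trans (size_scale_leq _ _))// size_prod_XsubC.
move=> x; rewrite inE => /predU1P[->|xs]; rewrite hornerD hornerZ.
  by rewrite divfK// addrC subrK.
have /rootP -> : root g x by rewrite root_prod_XsubC.
by rewrite mulr0 addr0 hr.
Qed.

Lemma poly_eq_on_nodes (s : seq F) (p q : {poly F}) : uniq s ->
  (size p <= size s)%N -> (size q <= size s)%N ->
  {in s, forall x, p.[x] = q.[x]} -> p = q.
Proof.
move=> us ps qs h; apply/eqP; rewrite -subr_eq0; apply/negPn/negP => d0.
have : all (root (p - q)) s.
  by apply/allP => x xs; rewrite rootE hornerD hornerN h// subrr.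
move/(max_poly_roots d0)/(_ us); apply/negP; rewrite -leqNgt.
by rewrite (leq_trans (size_polyD _ _))// size_polyN geq_max ps.
Qed.

End Interpolation.

(** The finiteness dichotomy used for sets of extremal points, which are not
    known to be finite. *)
Lemma uniq_seq_or_cover (T : choiceType) (E : set T) (k : nat) :
  (exists s : seq T, [/\ uniq s, size s = k & {in s, forall x, E x}]) \/
  (exists s : seq T, [/\ uniq s, (size s < k)%N & forall x, E x -> x \in s]).
Proof.
elim: k => [|k [[s [us ss sE]]|[s [us ss sE]]]]; first by left; exists [::].
- have [[x [Ex xs]]|h] := pselect (exists x, E x /\ x \notin s).
    left; exists (x :: s); split; rewrite /= ?ss ?xs//.
    by move=> y; rewrite inE => /predU1P[->//|]; exact: sE.
  right; exists s; split; rewrite ?ss// => x Ex.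
  by apply/negPn/negP => xs; apply: h; exists x.
- by right; exists s; split=> //; exact: leq_trans ss _.
Qed.

Section Deviation.
Variables (R : realType) (a : R).
Hypotheses (a_gt0 : 0 < a) (a_lt1 : a < 1).

Lemma X_setP x : X_set a x <-> (-1 <= x <= - a) \/ (a <= x <= 1).
Proof. by rewrite /X_set /= /setU /= !in_itv. Qed.

Lemma X_setN x : X_set a x -> X_set a (- x).
Proof. by move/X_setP => h; apply/X_setP; lra. Qed.

Lemma X_compact : compact (X_set a).
Proof. by apply: compactU; exact: segment_compact. Qed.

Lemma X_set1 : X_set a 1.
Proof. by apply/X_setP; right; rewrite lexx ltW. Qed.

(** [x / a] truncated to [[-1, 1]]: it replaces the discontinuous sign function
    in the extreme value arguments, as both agree on [X_set a]. *)
Definition sg_ext (x : R) : R := (`|x + a| - `|x - a|) / (2 * a).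

Lemma sg_extE x : X_set a x -> sg_ext x = Num.sg x.
Proof.
have [a0 a1] := (a_gt0, a_lt1); move=> /X_setP h; rewrite /sg_ext.
have -> : `|x + a| - `|x - a| = Num.sg x * (2 * a).
  case: h => /andP[h1 h2].
    rewrite ltr0_sg ?(@ler0_norm _ (x + a)) ?(@ler0_norm _ (x - a)); lra.
  rewrite gtr0_sg ?(@ger0_norm _ (x + a)) ?(@ger0_norm _ (x - a)); lra.
by rewrite mulfK// mulf_neq0 ?gt_eqF.
Qed.

Lemma continuous_sg_ext : continuous sg_ext.
Proof.
move=> x; apply: cvgM; last exact: cvg_cst.
by apply: cvgB; apply: cvg_norm; [apply: cvgD|apply: cvgB];
  (exact: cvg_id || exact: cvg_cst).
Qed.

Lemma continuous_err (p : {poly R}) : continuous (fun x => p.[x] - sg_ext x).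
Proof.
by move=> x; apply: cvgB; [exact: continuous_horner | exact: continuous_sg_ext].
Qed.

Lemma deviation_attained (p : {poly R}) : exists x, [/\ X_set a x,
  deviation a p = `|p.[x] - Num.sg x| &
  forall y, X_set a y -> `|p.[y] - Num.sg y| <= deviation a p].
Proof.
have X0 : X_set a !=set0 by exists 1; exact: X_set1.
have [|c] := @compact_EVT_max _ R (fun x => `|p.[x] - sg_ext x|) _ X0 X_compact.
  apply: continuous_subspaceT => x.
  by apply: cvg_norm; exact: continuous_err.
rewrite inE => Xc hc.
have hub : ubound [set `|p.[x] - Num.sg x| | x in X_set a] `|p.[c] - Num.sg c|.
  by move=> _ [y Xy <-]; rewrite -!sg_extE// hc// inE.
have hd : deviation a p = `|p.[c] - Num.sg c|.
  apply/eqP; rewrite eq_le; apply/andP; split.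
    by apply: ge_sup => //; exists `|p.[1] - Num.sg 1|, 1 => //; exact: X_set1.
  by apply: ub_le_sup; [exists `|p.[c] - Num.sg c| | exists c].
exists c; split=> // y Xy; rewrite hd; apply: hub; by exists y.
Qed.

Lemma deviation_ge (p : {poly R}) x :
  X_set a x -> `|p.[x] - Num.sg x| <= deviation a p.
Proof. by move=> Xx; have [c [_ _]] := deviation_attained p; exact. Qed.

Lemma deviation_le (p : {poly R}) M :
  (forall x, X_set a x -> `|p.[x] - Num.sg x| <= M) -> deviation a p <= M.
Proof. by have [c [Xc -> _]] := deviation_attained p; exact. Qed.

Lemma deviation_perturb (p q : {poly R}) M :
  (forall x, X_set a x -> `|p.[x] - q.[x]| <= M) ->
  deviation a p <= deviation a q + M.
Proof.
move=> h; apply: deviation_le => x Xx.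
rewrite -(subrKA q.[x]) (le_trans (ler_normD _ _))// addrC lerD ?h//.
exact: deviation_ge.
Qed.

Lemma horner_bounded (p : {poly R}) :
  exists2 M : R, 0 < M & forall x, X_set a x -> `|p.[x]| <= M.
Proof.
exists (deviation a p + 2).
  by rewrite ltr_wpDl// (le_trans _ (deviation_ge p X_set1)).
move=> x Xx; rewrite -[p.[x]](subrK (Num.sg x)) (le_trans (ler_normD _ _))//.
rewrite lerD ?deviation_ge// normr_sg; case: (_ != 0) => //=; first exact: ler1n.
Qed.

Lemma X_nodes k : exists s : seq R,
  [/\ uniq s, size s = k & {in s, forall x, X_set a x}].
Proof.
exists [seq a + (1 - a) / i.+1%:R | i <- iota 0 k]; split.
- rewrite map_inj_uniq ?iota_uniq// => i j /addrI.
  have d0 : 1 - a != 0 by rewrite subr_eq0 gt_eqF.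
  by move=> /(mulfI d0) /invr_inj/eqP; rewrite eqr_nat => /eqP[].
- by rewrite size_map size_iota.
- move=> _ /mapP[i _ ->]; apply/X_setP; right; rewrite lerDl.
  have d0 : 0 < 1 - a by rewrite subr_gt0.
  rewrite divr_ge0 ?ler0n ?(ltW d0)//= addrC -lerBrDr ler_pdivrMr ?ltr0n//.
  by rewrite ler_peMr ?(ltW d0)// ler1n.
Qed.

(** A polynomial of degree at most [n] is determined by its values at [n + 1]
    nodes of [X_set a], and a polynomial whose deviation is at most that of [0] has all
    these values in [[-2, 2]].  So it suffices to minimize the deviation over
    a compact cube, on which it is continuous. *)
Lemma best_approx_exists n : exists p : {poly R}, best_approx a n p.
Proof.
have [s [us ss sX]] := X_nodes n.+1.
have /choice[l hl] (i : 'I_n.+1) : exists r : {poly R}, (size r <= n.+1)%N /\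
    {in s, forall x, r.[x] = (x == s`_i)%:R}.
  by have [r] := poly_interpolation (fun x => (x == s`_i)%:R) us; rewrite ss; exists r.
have sXi (i : 'I_n.+1) : X_set a s`_i by apply: sX; rewrite mem_nth ?ss.
pose P (v : 'rV[R]_n.+1) : {poly R} := \sum_i v ord0 i *: l i.
have sizeP v : (size (P v) <= n.+1)%N.
  apply: (leq_trans (size_sum _ _ _)); apply/bigmax_leqP => i _.
  by rewrite (leq_trans (size_scale_leq _ _))//; case: (hl i).
have PK (p : {poly R}) : (size p <= n.+1)%N -> P (\row_i p.[s`_i]) = p.
  move=> sp; apply: (poly_eq_on_nodes us); rewrite ?ss//.
  move=> x /(nthP 0)[j]; rewrite ss => jn <-; rewrite /P horner_sum.
  rewrite (bigD1 (Ordinal jn)) //= big1 ?addr0.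
    by rewrite hornerZ mxE (hl _).2 ?mem_nth ?ss//= eqxx mulr1.
  move=> i ij; rewrite hornerZ (hl i).2 ?mem_nth ?ss//.
  rewrite nth_uniq ?ss//; case: eqP => [ji|]; last by rewrite mulr0.
  by case/eqP: ij; apply/val_inj.
have /choice[B hB] (i : 'I_n.+1) : exists M : R, 0 < M /\
    forall x, X_set a x -> `|(l i).[x]| <= M.
  by have [M M0 hM] := horner_bounded (l i); exists M.
pose K := [set v : 'rV[R]_n.+1 | forall i, `[-2 : R, 2]%classic (v ord0 i)].
have K0 : K !=set0 by exists 0 => i; rewrite /= in_itv/= mxE; lra.
have Kc : compact K.
  apply: (@rV_compact _ _ (fun=> `[-2 : R, 2]%classic)) => _.
  exact: segment_compact.
have Dc : {within K, continuous (fun v => deviation a (P v))}.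
  apply: continuous_subspaceT => v.
  pose T := 1 + \sum_i B i.
  have T0 : 0 < T.
    by rewrite ltr_wpDr// sumr_ge0// => i _; rewrite ltW//; case: (hB i).
  have FF : Filter (nbhs v) := nbhs_filter v.
  apply/(@cvgrPdist_le _ _ _ _ FF) => e e0.
  have near_le : nbhs v
      [set w : 'rV[R]_n.+1 | forall i, `|v ord0 i - w ord0 i| <= e / T].
    apply: (@filter_forall _ _ (fun i =>
      [set w : 'rV[R]_n.+1 | `|v ord0 i - w ord0 i| <= e / T]) _ FF) => i.
    have /(@cvgrPdist_le _ _ _ _ FF) := @coord_continuous R 1 n.+1 ord0 i v.
    by apply; rewrite divr_gt0.
  apply: filterS near_le => w hw.
  have diff (u z : 'rV[R]_n.+1) : (forall i, `|u ord0 i - z ord0 i| <= e / T) ->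
      deviation a (P u) <= deviation a (P z) + e.
    move=> huz; apply: deviation_perturb => x Xx.
    rewrite /P !horner_sum -sumrB (le_trans (ler_norm_sum _ _ _))//.
    apply: (@le_trans _ _ (\sum_i e / T * B i)).
      apply: ler_sum => i _; rewrite !hornerZ -mulrBl normrM ler_pM//.
      by have [_ /(_ x Xx)] := hB i.
    rewrite -mulr_sumr -mulrA ger_pMr// mulrC ler_pdivrMr// mul1r /T.
    by rewrite lerDr.
  rewrite ler_norml; have h1 := diff v w hw.
  have h2 : deviation a (P w) <= deviation a (P v) + e.
    by apply: diff => i; rewrite distrC.
  lra.
have [c _ hc] := EVT_min_rV K0 Kc Dc.
exists (P c); split=> // q sq.
have dev0 : deviation a 0 <= 1.
  apply: deviation_le => x _; rewrite horner0 sub0r normrN normr_sg.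
  by case: (_ != 0) => //=.
have [q1|q1] := leP (deviation a q) 1.
  rewrite -[in leRHS](PK q sq); apply: hc; rewrite inE => i.
  rewrite /= in_itv/= -ler_norml mxE.
  have := deviation_ge q (sXi i).
  have : `|Num.sg s`_i| <= 1 by rewrite normr_sg; case: (_ != 0) => //=.
  rewrite !ler_norml; lra.
rewrite (le_trans _ (ltW q1))//; apply: le_trans dev0.
have <- : P 0 = 0 by rewrite /P big1// => i _; rewrite mxE scale0r.
apply: hc; rewrite inE => i; rewrite /= in_itv/= mxE; lra.
Qed.

Lemma deviation_mean (p q : {poly R}) :
  deviation a (2^-1 *: (p + q)) <= 2^-1 * (deviation a p + deviation a q).
Proof.
apply: deviation_le => x Xx; rewrite hornerZ hornerD.
have := deviation_ge p Xx; have := deviation_ge q Xx.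
rewrite !ler_norml; lra.
Qed.

(** If the extremal points lie in a set [s] of at most [n + 1] points, some [r] of
    degree at most [n] takes there the same values as the error [e].
    For small [t > 0] the polynomial [p - t r] then has smaller deviation: where
    [e r] exceeds half of [L ^ 2] the square of the error decreases, and elsewhere
    compactness keeps [|e|] below some [L' < L]. *)
Lemma few_extremal_points n (p : {poly R}) (s : seq R) :
  best_approx a n p -> uniq s -> (size s <= n.+1)%N ->
  (forall x, X_set a x -> `|p.[x] - Num.sg x| = deviation a p -> x \in s) ->
  deviation a p = 0.
Proof.
move=> [sp hp] us ss hs; set L := deviation a p.
have L0 : 0 <= L by rewrite (le_trans _ (deviation_ge p X_set1)).
apply/eqP; rewrite eq_le L0 andbT leNgt; apply/negP => Lp.
pose e x := p.[x] - sg_ext x.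
have eE x : X_set a x -> e x = p.[x] - Num.sg x by move=> Xx; rewrite /e sg_extE.
have [r rs hr] := poly_interpolation e us.
have [M M0 hM] := horner_bounded r.
have ce : continuous e by exact: continuous_err.
have er_le x : X_set a x -> `|e x| <= L by move=> Xx; rewrite eE// deviation_ge.
pose K := X_set a `&` [set x | e x * r.[x] <= L ^+ 2 / 2].
have Kc : compact K.
  apply: compact_closedI; first exact: X_compact.
  apply: (@closed_comp _ _ (fun x => e x * r.[x]) [set y | y <= L ^+ 2 / 2]).
    move=> x _; apply: cvgM; [exact: ce | exact: continuous_horner].
  exact: closed_le.
have [L' [L'L L'0 hL']] : exists L', [/\ L' < L, 0 <= L' &
    forall x, K x -> `|e x| <= L'].
  have [K0|/set0P/negP/negPn/eqP K0] := pselect (K !=set0); last first.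
    by exists 0; split=> // x; rewrite K0.
  have [|c] := @compact_EVT_max _ R (fun x => `|e x|) _ K0 Kc.
    by apply: continuous_subspaceT => x; apply: cvg_norm; exact: ce.
  rewrite inE => -[Xc /= hc] hmax.
  exists `|e c|; split=> //; last by move=> x Kx; apply: hmax; rewrite inE.
  rewrite lt_neqAle er_le// andbT; apply/negP => /eqP ec.
  have cs : c \in s by apply: hs; rewrite -?eE.
  move: hc; rewrite hr// -expr2 -real_normK ?num_real// ec.
  have : 0 < L ^+ 2 by rewrite exprn_gt0.
  lra.
(* The first bound on t makes the quadratic term harmless near the extremal
   points; the second keeps the perturbed error below L away from them. *)
pose t := Num.min (L ^+ 2 / (2 * M ^+ 2)) ((L - L') / (2 * M)).
have t0 : 0 < t.
  by rewrite lt_min !divr_gt0 ?mulr_gt0 ?exprn_gt0 ?subr_gt0.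
have t1 : t * M ^+ 2 <= L ^+ 2 / 2.
  apply: (@le_trans _ _ (L ^+ 2 / (2 * M ^+ 2) * M ^+ 2)).
    by rewrite ler_wpM2r ?exprn_ge0 ?(ltW M0)// ge_min lexx.
  by rewrite le_eqVlt; apply/orP; left; apply/eqP; field; rewrite gt_eqF.
have t2 : t * M <= (L - L') / 2.
  apply: (@le_trans _ _ ((L - L') / (2 * M) * M)).
    by rewrite ler_wpM2r ?(ltW M0)// ge_min lexx orbT.
  by rewrite le_eqVlt; apply/orP; left; apply/eqP; field; rewrite gt_eqF.
have sq : (size (p - t *: r)%R <= n.+1)%N.
  rewrite (leq_trans (size_polyD _ _))// geq_max sp size_polyN.
  by rewrite (leq_trans (size_scale_leq _ _))// (leq_trans rs).
have := hp _ sq; rewrite leNgt => /negP; apply.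
have [x [Xx -> _]] := deviation_attained (p - t *: r).
have -> : (p - t *: r).[x] - Num.sg x = e x - t * r.[x].
  by rewrite eE// hornerD hornerN hornerZ addrAC.
rewrite -/L.
have rM := hM x Xx; have eL := er_le x Xx.
have [h|h] := leP (e x * r.[x]) (L ^+ 2 / 2).
  have := hL' x (conj Xx h) => h'.
  have h2 : `|t * r.[x]| <= t * M by rewrite normrM gtr0_norm// ler_pM2l.
  rewrite (le_lt_trans (ler_normB _ _))//; lra.
have rM2 : r.[x] ^+ 2 <= M ^+ 2.
  by rewrite -(real_normK (num_real r.[x])) lerXn2r ?nnegrE ?(ltW M0).
have eL2 : e x ^+ 2 <= L ^+ 2.
  by rewrite -(real_normK (num_real (e x))) lerXn2r ?nnegrE.
rewrite -(@ltr_pXn2r _ 2) ?nnegrE ?(ltW Lp)// real_normK ?num_real//.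
have h1 : t * (t * r.[x] ^+ 2) <= t * (L ^+ 2 / 2).
  by rewrite ler_pM2l// (le_trans _ t1)// ler_pM2l.
have h2 : t * (L ^+ 2 / 2) < t * (e x * r.[x]) by rewrite ltr_pM2l.
have h3 : 0 < t * (L ^+ 2 / 2) by rewrite mulr_gt0// divr_gt0// exprn_gt0.
have -> : (e x - t * r.[x]) ^+ 2 =
    e x ^+ 2 - 2 * (t * (e x * r.[x])) + t * (t * r.[x] ^+ 2) by ring.
lra.
Qed.

(** Where the mean [r] of [p] and [q] is extremal, so are [p] and [q] with the
    same sign, hence they agree there.  The case [L = 0] is apart: then [p] and [q]
    both equal the sign on the infinite set [X_set a]. *)
Lemma best_approx_unique n (p q : {poly R}) :
  best_approx a n p -> best_approx a n q -> p = q.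
Proof.
move=> bp bq; pose L := deviation a p.
have qL : deviation a q = L.
  by apply/eqP; rewrite eq_le; case: bp bq => [sp hp] [sq hq]; rewrite hq ?hp.
pose r : {poly R} := 2^-1 *: (p + q).
have rL : deviation a r <= L.
  by rewrite (le_trans (deviation_mean p q))// qL -/L; lra.
have sr : (size r <= n.+1)%N.
  rewrite (leq_trans (size_scale_leq _ _))// (leq_trans (size_polyD _ _))//.
  by rewrite geq_max bp.1 bq.1.
have br : best_approx a n r.
  by split=> // f sf; rewrite (le_trans rL)//; exact: bp.2.
have rLE : deviation a r = L.
  by apply/eqP; rewrite eq_le rL; exact: bp.2.
pose E := [set x | X_set a x /\ `|r.[x] - Num.sg x| = L].
have Epq x : E x -> p.[x] = q.[x].
  move=> [Xx]; rewrite hornerZ hornerD => h.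
  have := deviation_ge p Xx; have := deviation_ge q Xx.
  move: h; rewrite qL -/L.
  set u := p.[x]; set v := q.[x]; set g := Num.sg x => h.
  rewrite !ler_norml; have [h0|h0] := leP 0 (2^-1 * (u + v) - g).
    by move: h; rewrite ger0_norm//; lra.
  by move: h; rewrite ltr0_norm//; lra.
have [[s [us ss sE]]|[s [us ss sE]]] := uniq_seq_or_cover E n.+1.
  by apply: (poly_eq_on_nodes us); rewrite ?ss ?bp.1 ?bq.1// => x /sE; exact: Epq.
have L0 : L = 0.
  rewrite -rLE; apply: (few_extremal_points br us); first exact: ltnW.
  by move=> x Xx; rewrite rLE => h; apply: sE.
have [s' [us' ss' sX']] := X_nodes n.+1.
apply: (poly_eq_on_nodes us'); rewrite ?ss' ?bp.1 ?bq.1// => x /sX' Xx.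
apply: Epq; split=> //; apply/eqP; rewrite -rLE eq_le deviation_ge// rLE L0.
exact: normr_ge0.
Qed.

End Deviation.

(** * Normalized central binomial coefficients *)

Section CentralBinomial.
Variable F : numFieldType.

(** [C(2n, n) / 4 ^ n], the Taylor coefficients of [(1 - X) ^ (-1/2)].  The product
    form gives the recurrence at once, and makes sense in every field. *)
Definition cbin (n : nat) : F := \prod_(k < n) (k.*2.+1%:R / k.*2.+2%:R).

Lemma cbin0 : cbin 0 = 1.
Proof. exact: big_ord0. Qed.

Lemma cbinS n : cbin n.+1 = cbin n * (n.*2.+1%:R / n.*2.+2%:R).
Proof. exact: big_ord_recr. Qed.

Lemma cbinS_mul n : n.*2.+2%:R * cbin n.+1 = n.*2.+1%:R * cbin n.
Proof. by rewrite cbinS mulrCA [n.*2.+2%:R * _]mulrC divfK ?pnatr_eq0// mulrC. Qed.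

Lemma cbin_gt0 n : 0 < cbin n.
Proof. by elim: n => [|n IH]; rewrite ?cbin0 ?cbinS ?mulr_gt0 ?divr_gt0 ?ltr0n. Qed.

Lemma cbin_decS n : cbin n.+1 <= cbin n.
Proof. by rewrite cbinS ger_pMr ?cbin_gt0// ler_pdivrMr ?ltr0n// mul1r ler_nat. Qed.

Lemma cbin_dec n k : cbin (n + k) <= cbin n.
Proof.
by elim: k => [|k IH]; rewrite ?addn0// addnS (le_trans (cbin_decS _)).
Qed.

Lemma cbin_le1 n : cbin n <= 1.
Proof. by rewrite -cbin0; exact: (cbin_dec 0 n). Qed.

(** Each step loses at most the proportion [1 / (2n + 2)].  This is what allows
    the coefficients beyond the cut to be treated as constant. *)
Lemma cbin_slow_decay n k : cbin n - cbin (n + k) <= k%:R / n.*2.+2%:R * cbin n.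
Proof.
elim: k => [|k IH]; first by rewrite addn0 subrr mul0r mul0r.
rewrite addnS -[cbin n - _](subrKA (cbin (n + k))) -natr1 mulrDl mulrDl lerD// .
have -> : cbin (n + k) - cbin (n + k).+1 = 1 / (n + k).*2.+2%:R * cbin (n + k).
  rewrite cbinS -[in X in X - _](mulr1 (cbin (n + k))) -mulrBr mulrC; congr (_ * _).
  have h : (n + k).*2.+2%:R != 0 :> F by rewrite pnatr_eq0.
  by rewrite -[X in X - _](divff h) -mulrBl -natrB// subSnn.
rewrite ler_pM ?cbin_dec ?divr_ge0 ?ler0n// ?(ltW (cbin_gt0 _))//.
rewrite ler_pM2l// lef_pV2 ?posrE ?ltr0n// ler_nat !ltnS leq_double; exact: leq_addr.
Qed.

(** The square of the generating series is the geometric series.  By symmetry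
    [(n + 1) c_(n + 1)] is twice the sum of [i b_i b_(n + 1 - i)]; the recurrence for [2 i b_i]
    and symmetry again make it [(n + 1) c_n], where [c_n] is the convolution. *)
Lemma cbin_convolution n : \sum_(i < n.+1) cbin i * cbin (n - i) = 1.
Proof.
elim: n => [|n IH]; first by rewrite big_ord1 subn0 cbin0 mulr1.
pose s : F := \sum_(i < n.+2) cbin i * cbin (n.+1 - i).
have h1 : n.+1%:R * s = \sum_(i < n.+2) i.*2%:R * (cbin i * cbin (n.+1 - i)).
  have hrev : \sum_(i < n.+2) i%:R * (cbin i * cbin (n.+1 - i)) =
      \sum_(i < n.+2) (n.+1 - i)%:R * (cbin i * cbin (n.+1 - i)).
    rewrite [LHS](reindex_inj rev_ord_inj) /=; apply: eq_bigr => i _.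
    by rewrite subSS subKn 1?mulrC 1?[cbin i * _]mulrC 1?mulrC// -ltnS.
  transitivity (\sum_(i < n.+2) (n.+1 - i)%:R * (cbin i * cbin (n.+1 - i)) +
     \sum_(i < n.+2) i%:R * (cbin i * cbin (n.+1 - i))).
    rewrite -big_split mulr_sumr; apply: eq_bigr => i _ /=.
    by rewrite -mulrDl -natrD subnK// -ltnS.
  rewrite -hrev -big_split; apply: eq_bigr => i _ /=.
  by rewrite -mulrDl -natrD addnn.
have h2 : n.+1%:R * s = n.+1%:R * (\sum_(i < n.+1) cbin i * cbin (n - i)).
  rewrite h1 big_ord_recl /= mul0r add0r.
  transitivity (\sum_(i < n.+1) i.*2.+1%:R * (cbin i * cbin (n - i))).
    apply: eq_bigr => i _; rewrite /bump /= add1n subSS doubleS.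
    by rewrite mulrA cbinS_mul mulrA.
  have hrev : \sum_(i < n.+1) i.*2.+1%:R * (cbin i * cbin (n - i)) =
      \sum_(i < n.+1) (n - i).*2.+1%:R * (cbin i * cbin (n - i)).
    rewrite [LHS](reindex_inj rev_ord_inj) /=; apply: eq_bigr => i _.
    by rewrite subSS subKn 1?[cbin i * _]mulrC// -ltnS.
  have h20 : 2%:R != 0 :> F by rewrite pnatr_eq0.
  apply: (mulfI h20); rewrite [LHS]mulr_natl mulr2n {2}hrev -big_split /=.
  rewrite mulrA -natrM mulr_sumr; apply: eq_bigr => i _.
  rewrite -mulrDl -natrD; congr (_%:R * _).
  have := ltn_ord i; lia.
have h0 : n.+1%:R != 0 :> F by rewrite pnatr_eq0.
by move: (mulfI h0 h2); rewrite IH.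
Qed.

End CentralBinomial.

(** * Wallis bounds *)

Section Wallis.
Variable R : realType.

(** Primitives of the powers of the cosine, given by the reduction formula.
    Having them explicitly makes integrals unnecessary: the Wallis integrals are
    their values at [pi / 2]. *)
Fixpoint cos_primitive (n : nat) : R -> R :=
  match n with
  | 0 => id
  | 1 => sin
  | k.+2 => fun x =>
      k.+2%:R^-1 * (sin x * cos x ^+ k.+1 + k.+1%:R * cos_primitive k x)
  end.

Lemma cos_primitiveSS n (x : R) : cos_primitive n.+2 x =
  n.+2%:R^-1 * (sin x * cos x ^+ n.+1 + n.+1%:R * cos_primitive n x).
Proof. by []. Qed.

Lemma is_derive_cos_primitive n (x : R) : is_derive x 1 (cos_primitive n) (cos x ^+ n).
Proof.
suff [] : is_derive x 1 (cos_primitive n) (cos x ^+ n) /\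
          is_derive x 1 (cos_primitive n.+1) (cos x ^+ n.+1) by [].
elim: n => [|n [IH1 IH2]].
  by split; [rewrite expr0; exact: is_derive_id | rewrite expr1; exact: is_derive_sin].
split=> //.
have -> : cos_primitive n.+2 =
    n.+2%:R^-1 \*: (sin * cos ^+ n.+1 + n.+1%:R \*: cos_primitive n :> (R -> R)).
  by apply/funext => y; rewrite /= !fctE.
apply: is_derive_eq.
rewrite /GRing.scale /=.
have -> : (cos ^+ n.+1) x = cos x * cos x ^+ n :> R by rewrite fctE exprS.
have h : n.+2%:R != 0 :> R by rewrite pnatr_eq0.
apply: (mulfI h); rewrite mulVKf//.
have -> : cos x ^+ n.+2 = cos x ^+ n * cos x ^+ 2 by rewrite -exprD addn2.
have -> : n.+2%:R = n.+1%:R + 1 :> R by rewrite natr1.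
rewrite -[sin x * (_ * - _)]opprK.
have -> : - (sin x * (n.+1%:R * cos x ^+ n * - sin x)) = n.+1%:R * cos x ^+ n * sin x ^+ 2.
  by ring.
rewrite sin2cos2; ring.
Qed.

Lemma cos_primitive0 n : cos_primitive n 0 = 0.
Proof.
suff [] : cos_primitive n 0 = 0 /\ cos_primitive n.+1 0 = 0 by [].
elim: n => [|n [IH1 IH2]]; first by rewrite /= sin0.
by split=> //=; rewrite sin0 IH1 mul0r mulr0 addr0 mulr0.
Qed.

Lemma cos_primitive_pihalf_even k : cos_primitive k.*2 (pi / 2) = cbin R k * (pi / 2).
Proof.
elim: k => [|k IH]; first by rewrite /= cbin0 mul1r.
rewrite doubleS cos_primitiveSS IH cos_pihalf exprS mul0r mulr0 add0r cbinS.
rewrite mulrA mulrA; congr (_ * _).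
by rewrite mulrC [_^-1 * _]mulrC.
Qed.

Lemma cos_primitive_pihalf_odd k :
  cos_primitive k.*2.+1 (pi / 2) = (k.*2.+1%:R * cbin R k)^-1.
Proof.
elim: k => [|k IH]; first by rewrite /= sin_pihalf cbin0 mulr1 invr1.
rewrite doubleS cos_primitiveSS IH cos_pihalf exprS mul0r mulr0 add0r -cbinS_mul.
by rewrite [k.*2.+3%:R * _]mulrC !invfM; field; rewrite ?pnatr_eq0 ?gt_eqF ?cbin_gt0 ?pnatr_eq0.
Qed.

Lemma cos_primitive_pihalf_dec n : cos_primitive n.+1 (pi / 2) <= cos_primitive n (pi / 2).
Proof.
have hd (x : R) : is_derive x 1 (cos_primitive n \- cos_primitive n.+1)
    (cos x ^+ n - cos x ^+ n.+1).
  by apply: is_deriveB; exact: is_derive_cos_primitive.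
have pi0 : 0 <= pi / 2 :> R by rewrite divr_ge0 ?pi_ge0.
suff : (cos_primitive n \- cos_primitive n.+1) 0 <=
    (cos_primitive n \- cos_primitive n.+1) (pi / 2).
  have subE x : (cos_primitive n \- cos_primitive n.+1) x =
    cos_primitive n x - cos_primitive n.+1 x by [].
  by rewrite !subE !cos_primitive0 => h; lra.
apply: (@ger0_derive1_le_cc R (cos_primitive n \- cos_primitive n.+1) 0 (pi / 2)) => //.
- move=> x; rewrite in_itv/= => /andP[x0 x1].
  rewrite derive1E derive_val exprS -[X in X - _]mul1r -mulrBl mulr_ge0//.
  rewrite exprn_ge0// cos_ge0_pihalf// (ltW x1) andbT.
  by rewrite (le_trans _ (ltW x0))// oppr_le0.
- apply: continuous_subspaceT => x; apply: differentiable_continuous.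
  by apply/derivable1_diffP.
- by rewrite in_itv/= lexx.
- by rewrite in_itv/= lexx andbT.
Qed.

(** The values of [cos_primitive] at [pi / 2] are [b_n pi / 2] for even and
    [1 / ((2n + 1) b_n)] for odd index; they decrease with the index, and comparing
    consecutive ones bounds [b_n ^ 2] on both sides. *)
Lemma cbin_wallis n : (0 < n)%N ->
  2 / (n.*2.+1%:R * pi) <= cbin R n ^+ 2 <= (n%:R * pi)^-1.
Proof.
move=> n0.
have b0 := cbin_gt0 R n; have p0 := pi_gt0 R.
have q0 : 0 < cbin R n / (pi / 2) by rewrite !divr_gt0.
have sq (x p : R) : 0 < p -> x ^+ 2 = x * (p / 2) * (x / (p / 2)).
  by move=> ?; field; rewrite gt_eqF.
have lowE (c x p : R) : 0 < c -> 0 < x -> 0 < p ->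
    2 / (c * p) = (c * x)^-1 * (x / (p / 2)).
  by move=> ? ? ?; field; rewrite !gt_eqF.
rewrite (sq _ _ p0) -cos_primitive_pihalf_even; apply/andP; split.
  rewrite (lowE _ _ _ _ b0 p0) ?ltr0n//.
  by rewrite ler_pM2r// -cos_primitive_pihalf_odd cos_primitive_pihalf_dec.
case: n n0 b0 q0 => // k _ b0 q0.
have -> : (k.+1%:R * pi)^-1 =
    (k.*2.+1%:R * cbin R k)^-1 * (cbin R k.+1 / (pi / 2)).
  rewrite -cbinS_mul -(lowE _ _ _ _ b0 p0) ?ltr0n//.
  have -> : k.*2.+2%:R = 2 * k.+1%:R :> R by rewrite -doubleS -mul2n natrM.
  by rewrite -mulrA [(2 * _)^-1]invfM mulrA mulfV ?mul1r// pnatr_eq0.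
by rewrite ler_pM2r// -cos_primitive_pihalf_odd doubleS cos_primitive_pihalf_dec.
Qed.

End Wallis.

(** * Truncating the Laurent expansion of an inverse modulus *)

Section Estimates.
Variable C : numFieldType.
Implicit Types (w rho : C) (N m : nat).

Local Notation b := (cbin C).

(** A Taylor polynomial of [(1 - X) ^ (-1/2)]. *)
Definition invsqrt_poly N : {poly C} := \poly_(j < N) b j.

Lemma geo_sum w N : w != 1 -> \sum_(k < N) w ^+ k = (1 - w ^+ N) / (1 - w).
Proof.
move=> w1; rewrite -[1 - w ^+ N]opprB subrX1 -mulNr opprB mulrC mulKf//.
by rewrite subr_eq0 eq_sym.
Qed.

Lemma norm_lt1_neq1 w : `|w| < 1 -> w != 1.
Proof. by apply: contraTneq => ->; rewrite normr1 ltxx. Qed.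

Lemma geo_sum_le rho N : 0 <= rho -> rho < 1 ->
  \sum_(k < N) rho ^+ k <= (1 - rho)^-1.
Proof.
move=> r0 r1; rewrite geo_sum ?lt_eqF// ler_pdivrMr ?subr_gt0// mulVf.
  by rewrite gerBl exprn_ge0.
by rewrite gt_eqF ?subr_gt0.
Qed.

(** The closed form shows the sum to be the full series [(1 - rho) ^ (-2)] minus
    something nonnegative. *)
Lemma geo_sum1_le rho N : 0 <= rho -> rho < 1 ->
  \sum_(k < N) k.+1%:R * rho ^+ k <= (1 - rho) ^- 2.
Proof.
move=> r0 r1.
have -> : \sum_(k < N) k.+1%:R * rho ^+ k =
    (1 - rho ^+ N * (1 + N%:R * (1 - rho))) / (1 - rho) ^+ 2.
  have h : (1 - rho) != 0 by rewrite gt_eqF ?subr_gt0.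
  elim: N => [|N IH]; first by rewrite big_ord0 expr0 mul0r addr0 mulr1 subrr mul0r.
  rewrite big_ord_recr /= IH -natr1 [rho ^+ N.+1]exprS; field; exact: h.
rewrite -[leRHS]mul1r ler_pM2r ?invr_gt0 ?exprn_gt0 ?subr_gt0// gerBl.
by rewrite mulr_ge0 ?exprn_ge0// addr_ge0// mulr_ge0 ?ler0n// subr_ge0 ltW.
Qed.

Lemma coef_invsqrt_poly2 N n : 0 <= (invsqrt_poly N ^+ 2)`_n <= 1.
Proof.
have bp i : 0 <= (invsqrt_poly N)`_i <= b i.
  by rewrite coef_poly; case: ifP; rewrite ?lexx ltW ?cbin_gt0.
rewrite expr2 coefM; apply/andP; split.
  by apply: sumr_ge0 => i _; rewrite mulr_ge0//; case/andP: (bp i) (bp (n - i)%N) => ? _ /andP[].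
rewrite -[leRHS](cbin_convolution C n); apply: ler_sum => i _.
case/andP: (bp i) (bp (n - i)%N) => ? ? /andP[? ?]; exact: ler_pM.
Qed.

Lemma coef_invsqrt_poly2_low N n : (n < N)%N -> (invsqrt_poly N ^+ 2)`_n = 1.
Proof.
move=> nN; rewrite expr2 coefM -[RHS](cbin_convolution C n); apply: eq_bigr => i _.
rewrite !coef_poly (leq_ltn_trans _ nN) ?(leq_ltn_trans (leq_subr _ _) nN)//.
by rewrite -ltnS.
Qed.

(** The square of the Taylor polynomial has degree less than [2 N]; its
    coefficients are [1] below [N], as those of the geometric series, and lie
    in [[0, 1]] from [N] on. *)
Lemma invsqrt_poly_sqr N w rho : `|w| <= rho -> rho < 1 ->
  `|(invsqrt_poly N).[w] ^+ 2 - (1 - w)^-1| <= 2 * rho ^+ N / (1 - rho).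
Proof.
move=> wr r1; have r0 := le_trans (normr_ge0 w) wr.
have w1 := le_lt_trans wr r1.
have hw := norm_lt1_neq1 w1.
have d0 : 0 < 1 - rho by rewrite subr_gt0.
have hs : (size (invsqrt_poly N ^+ 2) <= N + N)%N.
  rewrite expr2 (leq_trans (size_polyMleq _ _))// (leq_trans (leq_pred _))//.
  by rewrite leq_add ?size_poly.
rewrite -horner_exp (horner_coef_wide _ hs) big_split_ord /=.
under eq_bigr => i _ do rewrite coef_invsqrt_poly2_low ?mul1r//.
rewrite geo_sum// mulrBl mul1r addrAC [_^-1 - _]addrC addrK.
have -> : 2 * rho ^+ N / (1 - rho) =
    rho ^+ N / (1 - rho) + rho ^+ N / (1 - rho) by rewrite -mulrA mulr_natl mulr2n.
rewrite addrC (le_trans (ler_normB _ _))//; apply: lerD.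
  rewrite (le_trans (ler_norm_sum _ _ _))//.
  apply: (@le_trans _ _ (rho ^+ N * \sum_(i < N) rho ^+ i)); last first.
    by rewrite ler_wpM2l ?exprn_ge0// geo_sum_le.
  rewrite mulr_sumr; apply: ler_sum => i _; rewrite normrM -exprD normrX.
  have /andP[c0 c1] := coef_invsqrt_poly2 N (N + i).
  rewrite ger0_norm// -[leRHS]mul1r ler_pM ?exprn_ge0//.
  by rewrite lerXn2r ?nnegrE.
rewrite normrM normfV normrX ler_pM ?exprn_ge0 ?invr_ge0//.
  by rewrite lerXn2r ?nnegrE.
rewrite lef_pV2 ?posrE ?normr_gt0 ?subr_eq0 1?eq_sym//.
by rewrite (le_trans _ (lerB_dist _ _))// normr1 lerB.
Qed.

(** The cost of freezing [b (N0 + (j + k))] to [b N0]: by [cbin_slow_decay] the term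
    of indices [j] and [k] changes by a factor at most [(j + k) / (2 N0 + 2)], which the
    geometric weights absorb. *)
Lemma frozen_coef_error rho w N0 M : `|w| = rho -> rho < 1 ->
  `|\sum_(j < M) \sum_(k < M - j)
      b j * b (N0 + (j + k)) * (w ^+ k * rho ^+ j.*2)
    - b N0 * \sum_(j < M) \sum_(k < M - j) b j * (w ^+ k * rho ^+ j.*2)|
  <= b N0 / N0.*2.+2%:R * (1 - rho) ^- 4.
Proof.
move=> wr r1; have r0 : 0 <= rho by rewrite -wr.
have hsum : \sum_(j < M) \sum_(k < M - j) (j + k)%:R * (rho ^+ k * rho ^+ j.*2)
   <= (1 - rho) ^- 4.
  apply: (@le_trans _ _ (\sum_(j < M) \sum_(k < M)
      (j.+1%:R * rho ^+ j) * (k.+1%:R * rho ^+ k))).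
    apply: ler_sum => j _.
    rewrite (big_ord_widen M (fun k => (j + k)%:R * (rho ^+ k * rho ^+ j.*2)) (leq_subr j M)).
    rewrite [leRHS](bigID (fun k : 'I_M => (k < M - j)%N)) /= -[leLHS]addr0.
    apply: lerD; last by apply: sumr_ge0 => k _; rewrite !mulr_ge0 ?ler0n ?exprn_ge0.
    apply: ler_sum => k _.
    rewrite mulrACA -natrM ler_pM ?ler0n ?mulr_ge0 ?exprn_ge0//.
      by rewrite ler_nat; lia.
    rewrite mulrC ler_wpM2r ?exprn_ge0// -addnn exprD.
    by rewrite ler_piMl ?exprn_ge0 ?exprn_ile1 ?(ltW r1).
  under eq_bigr => j _ do rewrite -mulr_sumr.
  rewrite -mulr_suml -expr2 -[4%N]/(2 * 2)%N exprM -exprVn.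
  rewrite lerXn2r ?nnegrE ?geo_sum1_le ?exprn_ge0 ?invr_ge0 ?subr_ge0 ?(ltW r1)//.
    by apply: sumr_ge0 => k _; rewrite !mulr_ge0 ?ler0n ?exprn_ge0.
  by rewrite exprn_ge0// subr_ge0 ltW.
rewrite mulr_sumr -sumrB (le_trans (ler_norm_sum _ _ _))//.
apply: le_trans (ler_wpM2l _ hsum); last by rewrite divr_ge0 ?ler0n ?ltW ?cbin_gt0.
rewrite mulr_sumr; apply: ler_sum => j _.
rewrite mulr_sumr -sumrB (le_trans (ler_norm_sum _ _ _))// mulr_sumr.
apply: ler_sum => k _.
have -> : b j * b (N0 + (j + k)) * (w ^+ k * rho ^+ j.*2) -
   b N0 * (b j * (w ^+ k * rho ^+ j.*2)) =
   - (b j * (b N0 - b (N0 + (j + k))) * (w ^+ k * rho ^+ j.*2)) by ring.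
rewrite normrN !normrM !normrX wr (ger0_norm r0) [leRHS]mulrA.
have hb : 0 <= b N0 - b (N0 + (j + k)) by rewrite subr_ge0 cbin_dec.
rewrite ler_wpM2r ?mulr_ge0 ?exprn_ge0// (ger0_norm hb) ger0_norm ?(ltW (cbin_gt0 _ _))//.
rewrite -[leRHS]mul1r ler_pM ?cbin_le1 ?(ltW (cbin_gt0 _ _))//.
by rewrite (le_trans (cbin_slow_decay _ _ _))// [leLHS]mulrC mulrA [leRHS]mulrAC.
Qed.

(** Once the coefficients are frozen, the sum over [k] is geometric and the sum
    over [j] is the Taylor polynomial at [rho ^ 2], close to [S]. *)
Lemma frozen_sum_limit rho w S M : `|w| = rho -> rho < 1 -> 1 <= S ->
  S ^+ 2 = (1 - rho ^+ 2)^-1 ->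
  `|\sum_(j < M) \sum_(k < M - j) b j * (w ^+ k * rho ^+ j.*2) - S / (1 - w)|
  <= 3 * rho ^+ M / (1 - rho) ^+ 2.
Proof.
move=> wr r1 S1 hS; have r0 : 0 <= rho by rewrite -wr.
have w1 : w != 1 by apply: norm_lt1_neq1; rewrite wr.
have d0 : 0 < 1 - rho by rewrite subr_gt0.
have dw : 1 - rho <= `|1 - w|.
  by rewrite (le_trans _ (lerB_dist _ _))// normr1 wr.
have dw0 : 0 < `|1 - w| by apply: lt_le_trans dw.
have -> : \sum_(j < M) \sum_(k < M - j) b j * (w ^+ k * rho ^+ j.*2) =
   ((invsqrt_poly M).[rho ^+ 2] - \sum_(j < M) b j * (rho ^+ j.*2 * w ^+ (M - j))) / (1 - w).
  rewrite horner_poly -sumrB mulr_suml; apply: eq_bigr => j _.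
  rewrite -mulr_sumr -mulr_suml geo_sum// -exprM mul2n.
  rewrite [b j * (_ * w ^+ _)]mulrA [b j * (_ * _)]mulrCA.
  ring.
have hsq : `|(invsqrt_poly M).[rho ^+ 2] - S| <= 2 * rho ^+ M / (1 - rho).
  have p0 : 0 <= (invsqrt_poly M).[rho ^+ 2].
    by rewrite horner_poly sumr_ge0// => i _; rewrite mulr_ge0 ?exprn_ge0 ?(ltW (cbin_gt0 _ _)).
  have hle : `|rho ^+ 2| <= rho.
    by rewrite ger0_norm ?exprn_ge0// expr2 ler_piMl// ltW.
  (* The Taylor polynomial P satisfies P + S >= 1 at this point, so |P - S| is at
     most |P ^ 2 - S ^ 2|. *)
  have := invsqrt_poly_sqr M hle r1; rewrite -hS subr_sqr normrM; apply: le_trans.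
  rewrite ler_peMr// ger0_norm ?addr_ge0 ?(le_trans ler01 S1)//.
  by rewrite (le_trans S1)// lerDr.
have htl : `|\sum_(j < M) b j * (rho ^+ j.*2 * w ^+ (M - j))| <= rho ^+ M / (1 - rho).
  rewrite (le_trans (ler_norm_sum _ _ _))//.
  apply: (@le_trans _ _ (rho ^+ M * \sum_(j < M) rho ^+ j)); last first.
    by rewrite ler_wpM2l ?exprn_ge0// geo_sum_le.
  rewrite mulr_sumr; apply: ler_sum => j _; rewrite !normrM !normrX wr (ger0_norm r0).
  rewrite -!exprD ger0_norm ?(ltW (cbin_gt0 _ _))//.
  have -> : (j.*2 + (M - j) = M + j)%N by have := ltn_ord j; lia.
  by rewrite ler_piMl ?cbin_le1// exprn_ge0.
rewrite -mulrBl normrM normfV.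
apply: (@le_trans _ _ ((2 * rho ^+ M / (1 - rho) + rho ^+ M / (1 - rho)) / (1 - rho))).
  rewrite ler_pM ?invr_ge0// ?lef_pV2 ?posrE//.
  by rewrite addrAC (le_trans (ler_normB _ _))// lerD.
rewrite le_eqVlt; apply/orP; left; apply/eqP.
by field; rewrite gt_eqF.
Qed.

(** The terms of the product of two Taylor polynomials with index difference
    greater than [m], reindexed by [i = j + (m + 1) + k]; it applies to conjugate
    numbers of modulus [rho]. *)
Lemma offdiag_sum rho w w' m M : w * w' = rho ^+ 2 ->
  \sum_(j < M + m.+1) \sum_(i < M + m.+1 | (j + m < i)%N)
     b i * b j * (w ^+ i * w' ^+ j) =
  w ^+ m.+1 * \sum_(j < M) \sum_(k < M - j)
     b j * b (m.+1 + (j + k)) * (w ^+ k * rho ^+ j.*2).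
Proof.
move=> ww.
have inner (F : nat -> C) n p : \sum_(i < n | (p < i)%N) F i =
    \sum_(k < n - p.+1) F (k + p.+1)%N.
  by rewrite -(big_geq_mkord p.+1 n xpredT F) -{1}[p.+1]add0n big_addn big_mkord.
transitivity (\sum_(j < M + m.+1) \sum_(k < M - j)
    w ^+ m.+1 * (b j * b (m.+1 + (j + k)) * (w ^+ k * rho ^+ j.*2))).
  apply: eq_bigr => j _; rewrite (inner (fun i => b i * b j * (w ^+ i * w' ^+ j))).
  rewrite -addnS subnDr; apply: eq_bigr => k _.
  rewrite -mul2n exprM -ww exprMn.
  have -> : (m.+1 + (j + k) = k + (j + m.+1))%N by lia.
  by rewrite !exprD; ring.
rewrite big_split_ord /= [X in _ + X]big1 ?addr0; last first.
  move=> j _; apply: big1 => k _; exfalso; have := ltn_ord k => /=; lia.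
rewrite mulr_sumr; apply: eq_bigr => j _; rewrite mulr_sumr.
by apply: eq_bigr => k _.
Qed.

Lemma offdiag_bound rho w S m M : `|w| = rho -> rho < 1 -> 1 <= S ->
  S ^+ 2 = (1 - rho ^+ 2)^-1 ->
  `|w ^+ m.+1 * \sum_(j < M) \sum_(k < M - j)
      b j * b (m.+1 + (j + k)) * (w ^+ k * rho ^+ j.*2)
    - b m.+1 * S * (w ^+ m.+1 / (1 - w))| <=
  rho ^+ m.+1 * b m.+1 / (m.+2.*2)%:R * (1 - rho) ^- 4
  + 3 * rho ^+ M / (1 - rho) ^+ 2.
Proof.
move=> wr r1 S1 hS; have r0 : 0 <= rho by rewrite -wr.
have b0 := ltW (cbin_gt0 C m.+1).
have h1 := frozen_coef_error m.+1 M wr r1; have h2 := frozen_sum_limit M wr r1 S1 hS.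
set U := \sum_(j < M) _ in h1 *; set V := \sum_(j < M) _ in h1 h2.
have b1 := cbin_le1 C m.+1; move: (b m.+1) b0 b1 h1 => B b0 b1 h1.
have -> : w ^+ m.+1 * U - B * S * (w ^+ m.+1 / (1 - w)) =
   w ^+ m.+1 * (U - B * V) + w ^+ m.+1 * B * (V - S / (1 - w)).
  by ring.
rewrite (le_trans (ler_normD _ _))// !normrM !normrX wr.
rewrite (ger0_norm b0).
apply: lerD.
  by rewrite -!mulrA ler_wpM2l ?exprn_ge0// mulrA.
apply: le_trans h2; rewrite ler_piMl// mulr_ile1 ?exprn_ge0//.
by rewrite exprn_ile1// ltW.
Qed.

End Estimates.

Section ClosedEstimates.
Variable C : numClosedFieldType.
Local Notation b := (cbin C).

Lemma cbin_conj n : (b n)^* = b n.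
Proof. by apply: conj_Creal; rewrite ger0_real// ltW// cbin_gt0. Qed.

(** The central terms of [|P w| ^ 2], where [P] is the Taylor polynomial, are the
    approximant.  The two blocks of discarded terms are conjugate to each other and each
    is estimated by [offdiag_bound], while [|P w| ^ 2] is close to [1 / |1 - w|]. *)
Lemma truncation_estimate (rho w S : C) m M : `|w| = rho -> rho < 1 -> 1 <= S ->
  S ^+ 2 = (1 - rho ^+ 2)^-1 ->
  `| `|1 - w| * (\sum_(i < M + m.+1)
        \sum_(j < M + m.+1 | (i <= j + m)%N && (j <= i + m)%N)
        b i * b j * (w ^+ i * w^* ^+ j)) - 1
     + `|1 - w| * (b m.+1 * S * (w ^+ m.+1 / (1 - w))
                 + b m.+1 * S * (w^* ^+ m.+1 / (1 - w^*)))| <=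
  2 * rho ^+ m.+1 * b m.+1 / m.+2%:R * (1 - rho) ^- 4
  + 16 * rho ^+ M / (1 - rho) ^+ 2.
Proof.
move=> wr r1 S1 hS; have r0 : 0 <= rho by rewrite -wr.
have wr' : `|w^*| = rho by rewrite norm_conjC.
set N := (M + m.+1)%N; set r : C := `|1 - w|; set Q := \sum_(i < N) _.
have w1 : w != 1 by apply: norm_lt1_neq1; rewrite wr.
have r_gt0 : 0 < r by rewrite normr_gt0 subr_eq0 eq_sym.
have r_le2 : r <= 2.
  by rewrite (le_trans (ler_normB _ _))// normr1 wr -[2]/(1 + 1) lerD2l ltW.
have d0 : 0 < 1 - rho by rewrite subr_gt0.
have ww : w * w^* = rho ^+ 2 by rewrite -normCK wr.
have ww' : w^* * w = rho ^+ 2 by rewrite mulrC.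
have := offdiag_bound m M wr r1 S1 hS; rewrite -(offdiag_sum m M ww) -/N.
set U := \sum_(j < N) _; set u := b m.+1 * S * _ => hU.
have := offdiag_bound m M wr' r1 S1 hS; rewrite -(offdiag_sum m M ww') -/N.
set U' := \sum_(j < N) _; set u' := b m.+1 * S * _ => hU'.
move: hU hU'; set e := (rho ^+ _ * _ / _ * _ + _) => hU hU'.
have full : `|(invsqrt_poly C N).[w] ^+ 2| = Q + U + U'.
  have -> : `|(invsqrt_poly C N).[w] ^+ 2| = (invsqrt_poly C N).[w] * (invsqrt_poly C N).[w^*].
    rewrite normrX normCK; congr (_ * _).
    rewrite !horner_poly rmorph_sum; apply: eq_bigr => i _.
    by rewrite rmorphM; congr (_ * _); [exact: cbin_conj | exact: rmorphXn].
  transitivity (\sum_(i < N) \sum_(j < N) b i * b j * (w ^+ i * w^* ^+ j)).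
    rewrite !horner_poly mulr_suml; apply: eq_bigr => i _.
    by rewrite mulr_sumr; apply: eq_bigr => j _; rewrite mulrACA.
  have -> : U = \sum_(i < N) \sum_(j < N | (j + m < i)%N) b i * b j * (w ^+ i * w^* ^+ j).
    by rewrite (exchange_big_dep xpredT).
  have -> : U' = \sum_(i < N) \sum_(j < N | (i + m < j)%N) b i * b j * (w ^+ i * w^* ^+ j).
    apply: eq_bigr => i _; apply: eq_bigr => j _.
    by rewrite [b j * _]mulrC [_ ^+ j * _]mulrC.
  rewrite -!big_split /=; apply: eq_bigr => i _.
  rewrite (bigID (fun j : 'I_N => (i <= j + m)%N)) /= (bigID (fun j : 'I_N => (j <= i + m)%N)) /=.
  rewrite addrAC; congr (_ + _ + _); apply: eq_bigl => j; lia.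
have hP : `|Q + U + U' - r^-1| <= 2 * rho ^+ N / (1 - rho).
  have wle : `|w| <= rho by rewrite wr.
  have := invsqrt_poly_sqr N wle r1; apply: le_trans.
  by rewrite -full -normfV ler_dist_dist.
have -> : r * Q - 1 + r * (u + u') =
    r * (Q + U + U' - r^-1) - r * (U - u) - r * (U' - u').
  rewrite mulrBr divff ?gt_eqF//; ring.
have step x y : `|x| <= y -> `|r * x| <= 2 * y.
  by move=> xy; rewrite normrM normr_id ler_pM.
rewrite (le_trans (ler_normB _ _))// (le_trans (lerD (ler_normB _ _) (lexx _)))//.
rewrite (le_trans (lerD (lerD (step _ _ hP) (step _ _ hU)) (step _ _ hU')))//.
have hN : 2 * (2 * rho ^+ N / (1 - rho)) <= 4 * rho ^+ M / (1 - rho) ^+ 2.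
  rewrite !mulrA -natrM ler_pM ?mulr_ge0 ?invr_ge0 ?exprn_ge0 ?(ltW d0)//.
    rewrite ler_wpM2l// /N exprD ler_piMr ?exprn_ge0//.
    by rewrite exprn_ile1// ltW.
  rewrite lef_pV2 ?posrE ?exprn_gt0// expr2 ler_piMl ?(ltW d0)//.
  by rewrite gerBl.
have -> : 16%:R = 4%:R + 2%:R * 3%:R + 2%:R * 3%:R :> C by ring.
rewrite -addrA (le_trans (lerD hN (lexx _)))// /e -mul2n natrM.
rewrite le_eqVlt; apply/orP; left; apply/eqP.
have h1 : 1 - rho != 0 by rewrite gt_eqF.
have h2 : m.+2%:R != 0 :> C by rewrite pnatr_eq0.
by move: (cbin C m.+1) (m.+2%:R : C) h2 => B k h2; field; rewrite h1 h2.
Qed.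

End ClosedEstimates.

(** * The truncation error in polar coordinates *)

Lemma rmorph_cbin (F K : numFieldType) (f : {rmorphism F -> K}) n :
  f (cbin F n) = cbin K n.
Proof.
by rewrite rmorph_prod; apply: eq_bigr => k _; rewrite fmorph_div !rmorph_nat.
Qed.

Section Polar.
Variables (R : realType) (rho : R).
Hypotheses (rho_ge0 : 0 <= rho) (rho_lt1 : rho < 1).
Implicit Types th : R.

Definition radius th := Num.sqrt (1 + 2 * rho * cos th + rho ^+ 2).

(** The argument of [1 + rho * exp (i th)], whose real part is positive. *)
Definition angle th := atan (rho * sin th / (1 + rho * cos th)).

Lemma real_part_gt0 th : 0 < 1 + rho * cos th.
Proof.
have h : `|rho * cos th| <= rho.
  by rewrite normrM (ger0_norm rho_ge0) ler_piMr// cos_max.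
by move: h; rewrite ler_norml; have := rho_lt1; lra.
Qed.

Lemma radius_sqr th : (1 + rho * cos th) ^+ 2 + (rho * sin th) ^+ 2 =
  1 + 2 * rho * cos th + rho ^+ 2.
Proof. rewrite exprMn sin2cos2; ring. Qed.

Lemma radius_gt0 th : 0 < radius th.
Proof.
by rewrite sqrtr_gt0 -radius_sqr ltr_wpDr ?sqr_ge0// exprn_gt0// real_part_gt0.
Qed.

Lemma radius2 th : radius th ^+ 2 = 1 + 2 * rho * cos th + rho ^+ 2.
Proof.
by rewrite sqr_sqrtr// -radius_sqr addr_ge0 ?sqr_ge0.
Qed.

Lemma cos_angle th : radius th * cos (angle th) = 1 + rho * cos th.
Proof.
have d0 := real_part_gt0 th; have r0 := radius_gt0 th.
rewrite cos_atan.
have -> : 1 + (rho * sin th / (1 + rho * cos th)) ^+ 2 =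
    (radius th / (1 + rho * cos th)) ^+ 2.
  rewrite !expr_div_n radius2 -radius_sqr mulrDl divff// gt_eqF ?exprn_gt0//.
by rewrite sqrtr_sqr gtr0_norm ?divr_gt0// invf_div mulrC divfK// gt_eqF.
Qed.

Lemma sin_angle th : radius th * sin (angle th) = rho * sin th.
Proof.
have d0 := real_part_gt0 th.
have c0 : cos (angle th) != 0.
  apply/eqP => h; have := cos_angle th; rewrite h mulr0 => h'.
  by rewrite -h' ltxx in d0.
have : tan (angle th) = rho * sin th / (1 + rho * cos th) by rewrite atanK.
move=> h; rewrite -[RHS](divfK (lt0r_neq0 d0)) -h -cos_angle /tan.
by move: (cos _) (sin _) (radius _) c0 => c s r c0; field.
Qed.

Local Open Scope complex_scope.

Lemma ReD (x y : R[i]) : complex.Re (x + y) = complex.Re x + complex.Re y.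
Proof. by case: x y => ? ? []. Qed.

Lemma ReB (x y : R[i]) : complex.Re (x - y) = complex.Re x - complex.Re y.
Proof. by case: x y => ? ? []. Qed.

Lemma ReZ (x : R) (y : R[i]) : complex.Re (x%:C * y) = x * complex.Re y.
Proof. by case: y => u v /=; rewrite mul0r subr0. Qed.

Lemma Re_sum (I : Type) (r : seq I) (P : pred I) (F : I -> R[i]) :
  complex.Re (\sum_(i <- r | P i) F i) = \sum_(i <- r | P i) complex.Re (F i).
Proof. exact: (big_morph _ ReD). Qed.

Lemma de_moivre th n : (cos th +i* sin th) ^+ n = cos (n%:R * th) +i* sin (n%:R * th).
Proof.
elim: n => [|n IH]; first by rewrite mul0r cos0 sin0.
rewrite exprS IH -natr1 mulrDl mul1r addrC cosD sinD.
by apply/eqP; rewrite eq_complex /=; apply/andP; split; apply/eqP; ring.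
Qed.

Lemma conj_de_moivre th n : (cos th -i* sin th) ^+ n = cos (n%:R * th) -i* sin (n%:R * th).
Proof.
have := de_moivre (- th) n.
by rewrite mulrN !cosN !sinN.
Qed.

(** The cosine polynomial of degree at most [m] made of the central terms of the
    square modulus of the Taylor polynomial of degree [N - 1], at
    [w = - rho * exp (i th)]. *)
Definition truncated_sum m N th : R :=
  \sum_(i < N) \sum_(j < N | (i <= j + m)%N && (j <= i + m)%N)
    cbin R i * cbin R j * ((- rho) ^+ (i + j) * cos (i%:R * th - j%:R * th)).

(** The real part of [truncation_estimate] at [w = - rho * exp (i th)].
    Since [1 - w] has modulus [radius th] and argument [angle th], the two leading terms
    have the same real part and add up to a cosine of constant amplitude. *)
Lemma truncated_sum_estimate S m M th : 1 <= S -> S ^+ 2 = (1 - rho ^+ 2)^-1 ->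
  `|radius th * truncated_sum m (M + m.+1) th - 1
     + 2 * cbin R m.+1 * S * (- rho) ^+ m.+1 * cos (m.+1%:R * th - angle th)| <=
  2 * rho ^+ m.+1 * cbin R m.+1 / m.+2%:R * (1 - rho) ^- 4
  + 16 * rho ^+ M / (1 - rho) ^+ 2.
Proof.
move=> S1 hS.
pose z : R[i] := cos th +i* sin th.
pose w : R[i] := (- rho)%:C * z.
have normz : `|z| = 1 by rewrite normc_def /= cos2Dsin2 sqrtr1.
have wr : `|w| = rho%:C.
  by rewrite normrM normz mulr1 normc_def /= expr0n addr0 sqrtr_sqr normrN ger0_norm.
have bE n : cbin R[i] n = (cbin R n)%:C by rewrite (rmorph_cbin (real_complex R)).
have wE n : w ^+ n = ((- rho) ^+ n)%:C * (cos (n%:R * th) +i* sin (n%:R * th)).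
  by rewrite exprMn de_moivre rmorphXn.
have wcE n : w^*%R ^+ n = ((- rho) ^+ n)%:C * (cos (n%:R * th) -i* sin (n%:R * th)).
  rewrite -conj_de_moivre rmorphXn -exprMn; congr (_ ^+ _).
  by apply/eqP; rewrite eq_complex /=; apply/andP; split; apply/eqP; ring.
have r0 := radius_gt0 th.
have n1w : `|1 - w| = (radius th)%:C.
  rewrite normc_def /radius -radius_sqr; congr (Num.sqrt _)%:C.
  by rewrite /=; ring.
have RHSE : 2 * rho%:C ^+ m.+1 * cbin R[i] m.+1 / m.+2%:R * (1 - rho%:C) ^- 4
    + 16 * rho%:C ^+ M / (1 - rho%:C) ^+ 2 =
    (2 * rho ^+ m.+1 * cbin R m.+1 / m.+2%:R * (1 - rho) ^- 4
    + 16 * rho ^+ M / (1 - rho) ^+ 2)%:C.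
  have gen (x c k y u v : R) : (2%:R * x * c / k / y + 16%:R * u / v)%:C =
      2%:R * x%:C * c%:C / k%:C / y%:C + 16%:R * u%:C / v%:C.
    by rewrite rmorphD !rmorphM !fmorphV !rmorph_nat.
  have hX (x : R) k : (x ^+ k)%:C = x%:C ^+ k by exact: rmorphXn.
  have hB (x : R) : (1 - x)%:C = 1 - x%:C by rewrite rmorphB rmorph1.
  have hn k : (k%:R)%:C = k%:R :> R[i] by rewrite rmorph_nat.
  by rewrite bE gen !hX !hB hn.
have hre n : complex.Re (w ^+ n / (1 - w)) =
    (- rho) ^+ n * cos (n%:R * th - angle th) / radius th.
  rewrite wE -mulrA ReZ -mulrA; congr (_ * _).
  have -> : (1 - w)^-1 = (1 + rho * cos th) / radius th ^+ 2
      -i* (rho * sin th / radius th ^+ 2).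
    have -> : 1 - w = (1 + rho * cos th) +i* (rho * sin th).
      by apply/eqP; rewrite eq_complex /=; apply/andP; split; apply/eqP; ring.
    by rewrite radius2 -radius_sqr.
  rewrite /= -cos_angle -sin_angle cosB.
  move: (cos (n%:R * th)) (sin (n%:R * th)) (cos (angle th)) (sin (angle th)) r0.
  move: (radius th) => r c s c' s' r0; field; exact: lt0r_neq0.
have hrec n : complex.Re (w^*%R ^+ n / (1 - w^*%R)) =
    (- rho) ^+ n * cos (n%:R * th - angle th) / radius th.
  rewrite -hre.
  have -> : w^*%R ^+ n / (1 - w^*%R) = ((w ^+ n / (1 - w))^*)%R.
    by rewrite fmorph_div rmorphB rmorphXn rmorph1.
  by case: (w ^+ n / (1 - w)).
have rho1C : rho%:C < 1 by rewrite -[1]/(1%:C) ltcR.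
have S1C : 1 <= S%:C by rewrite -[1]/(1%:C) lecR.
have hSC : S%:C ^+ 2 = (1 - rho%:C ^+ 2)^-1.
  by rewrite -[1]/(1%:C) -!rmorphXn -rmorphB -fmorphV hS.
have hC := truncation_estimate m M wr rho1C S1C hSC.
rewrite n1w RHSE in hC.
rewrite -lecR; apply: le_trans hC; apply: le_trans (normc_ge_Re _).
rewrite lecR le_eqVlt; apply/orP; left; apply/eqP; congr `|_|.
rewrite ReD ReB !ReZ ReD bE -!rmorphM !ReZ hre hrec; congr (_ - _ + _).
  congr (_ * _); rewrite Re_sum; apply: eq_bigr => i _.
  rewrite Re_sum; apply: eq_bigr => j _.
  rewrite !bE -rmorphM ReZ; congr (_ * _).
  rewrite wE wcE mulrACA -rmorphM -exprD ReZ; congr (_ * _).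
  by rewrite /= cosB mulrN opprK.
move: (cos _) ((- rho) ^+ _) (radius th) r0 (cbin R _) => c x r r0 B.
by field; exact: lt0r_neq0.
Qed.

End Polar.

(** * Alternation *)

Section EquiPoints.
Variables (R : realType) (rho : R).
Hypotheses (rho_ge0 : 0 <= rho) (rho_lt1 : rho < 1).

Definition phase n th := n%:R * th - angle rho th.

Lemma continuous_phase n : continuous (phase n).
Proof.
move=> th; apply: cvgB; first by apply: cvgM; [exact: cvg_cst | exact: cvg_id].
apply: (@continuous_comp R R R (fun t => rho * sin t / (1 + rho * cos t)) (@atan R));
  last exact: continuous_atan.
apply: cvgM; first by apply: cvgM; [exact: cvg_cst | exact: continuous_sin].
apply: cvgV; first by rewrite gt_eqF// real_part_gt0.
apply: cvgD; first exact: cvg_cst.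
by apply: cvgM; [exact: cvg_cst | exact: continuous_cos].
Qed.

(** The phase need not be shown monotone: each new point is found by
    the intermediate value theorem to the right of the preceding one. *)
Lemma phase_points n k : (k <= n)%N -> exists t : nat -> R,
  (forall j, (j <= k)%N -> 0 <= t j <= pi /\ phase n (t j) = j%:R * pi) /\
  (forall i j, (i < j)%N -> (j <= k)%N -> t i < t j).
Proof.
have pi0 := pi_gt0 R.
have phase0 : phase n 0 = 0.
  by rewrite /phase /angle sin0 !mulr0 mul0r atan0 subrr.
have phasepi : phase n pi = n%:R * pi.
  by rewrite /phase /angle sinpi mulr0 mul0r atan0 subr0.
elim: k => [_|k IH kn].
  exists (fun=> 0); split=> [j|i j]; last by case: j.
  by rewrite leqn0 => /eqP ->; rewrite phase0 mul0r lexx (ltW pi0).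
have [t [ht tlt]] := IH (ltnW kn).
have [/andP[tk0 tkpi] phk] := ht k (leqnn k).
have hk : k%:R * pi <= k.+1%:R * (pi : R) <= n%:R * pi.
  by apply/andP; split; rewrite ler_pM2r// ler_nat.
have [||x] := @IVT R (phase n) (t k) pi (k.+1%:R * pi) tkpi.
- by apply: continuous_subspaceT; exact: continuous_phase.
- case/andP: hk => h1 h2.
  by rewrite phk phasepi ge_min le_max h1 h2 orbT.
rewrite in_itv /= => /andP[tkx xpi] phx.
have tkx' : t k < x.
  rewrite lt_neqAle tkx andbT; apply/eqP => tkxE.
  move: phx; rewrite -tkxE phk => /(mulIf (lt0r_neq0 pi0))/eqP.
  by rewrite eqr_nat eqn_leq ltnn andbF.
exists (fun j => if (j <= k)%N then t j else x); split=> [j|i j ij].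
  rewrite leq_eqVlt => /orP[/eqP ->|]; last by rewrite ltnS => jk; rewrite jk; exact: ht.
  by rewrite ltnn phx xpi (le_trans tk0).
rewrite leq_eqVlt => /orP[/eqP jE|]; last first.
  by rewrite ltnS => jk; rewrite jk (leq_trans (ltnW ij) jk); exact: tlt.
move: ij; rewrite jE ltnS => ik; rewrite ik ltnn.
move: ik; rewrite leq_eqVlt => /orP[/eqP -> //|ik].
by rewrite (lt_trans _ tkx')// tlt.
Qed.

Lemma cos_natpi j : cos (j%:R * pi) = (-1) ^+ j :> R.
Proof.
elim: j => [|j IH]; first by rewrite mul0r cos0.
by rewrite -natr1 mulrDl mul1r cosDpi IH exprS mulN1r.
Qed.

End EquiPoints.

(** Locating the roots to the right of [y n] is what keeps them distinct when one
    more is found to its left. *)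
Lemma alternating_roots (R : rcfType) (f : {poly R}) (y : nat -> R) n :
  (forall i j, (i < j)%N -> (j <= n)%N -> y j < y i) ->
  (forall j, (j <= n)%N -> 0 < (-1) ^+ j * f.[y j]) ->
  exists s : seq R, [/\ uniq s, size s = n, all (root f) s &
    {in s, forall x, y n < x}].
Proof.
elim: n => [|n IH] ylt fy; first by exists [::].
have [|j jn|s [us ss rs sy]] := IH.
- by move=> i j ij jn; apply: ylt => //; exact: leqW.
- by apply: fy; exact: leqW.
have yn : y n.+1 < y n by exact: ylt.
have h1 := fy n (leqnSn n); have h2 := fy n.+1 (leqnn _).
have [x /andP[x1 x2] rx] : exists2 x, y n.+1 <= x <= y n & root f x.
  move: h1 h2; rewrite exprS mulN1r mulNr oppr_gt0 => h1 h2.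
  have [] := @poly_ivt R (((-1) ^+ n)%:P * f) (y n.+1) (y n) (ltW yn).
    by rewrite !hornerCM (ltW h1) (ltW h2).
  move=> x hx; rewrite rootM rootC signr_eq0 /= => rx; by exists x.
have fne j : (j <= n.+1)%N -> ~~ root f (y j).
  by move=> jn; apply/negP => /rootP h; have := fy j jn; rewrite h mulr0 ltxx.
have x1' : y n.+1 < x.
  rewrite lt_neqAle x1 andbT; apply: contraNneq (fne n.+1 (leqnn _)) => ->; exact: rx.
have x2' : x < y n.
  rewrite lt_neqAle x2 andbT; apply: contraNneq (fne n (leqnSn _)) => <-; exact: rx.
exists (x :: s); split; rewrite /= ?ss ?us ?rs ?rx ?andbT//.
  by apply/negP => /sy; rewrite ltNge (ltW x2').
move=> u; rewrite inE => /predU1P[-> //|/sy]; exact: lt_trans.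
Qed.

Section OddRoots.
Variable R : rcfType.

(** By oddness every positive root counts twice. *)
Lemma odd_alternation (f : {poly R}) (y : nat -> R) n :
  (forall x, f.[- x] = - f.[x]) -> 0 <= y n ->
  (forall i j, (i < j)%N -> (j <= n)%N -> y j < y i) ->
  (forall j, (j <= n)%N -> 0 < (-1) ^+ j * f.[y j]) ->
  (2 * n < size f)%N.
Proof.
move=> fodd y0 ylt fy.
have [s [us ss rs sy]] := alternating_roots ylt fy.
have f0 : f != 0.
  by apply/eqP => f0; have := fy n (leqnn n); rewrite f0 horner0 mulr0 ltxx.
have := @max_poly_roots _ f (s ++ [seq - x | x <- s]) f0.
rewrite size_cat size_map ss addnn mul2n; apply.
  rewrite all_cat rs; apply/allP => _ /mapP[x xs ->].
  by rewrite rootE fodd oppr_eq0; exact: (allP rs).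
rewrite cat_uniq us (map_inj_uniq oppr_inj) us andbT /=.
apply/hasPn => _ /mapP[x xs ->]; apply/negP => /sy.
have x0 : 0 <= x by rewrite (le_trans y0)// ltW// sy.
by rewrite ltNge (le_trans _ y0)// oppr_le0.
Qed.

End OddRoots.

(** * Passage from the angle to the interval *)

Section Main.
Variables (R : realType) (a : R).
Hypotheses (a_gt0 : 0 < a) (a_lt1 : a < 1).

Definition ratio := (1 - a) / (1 + a).
Local Notation rho := ratio.

(** With [z = exp (i th)] this is [(1 + a) / 2 * |1 + rho z|], which runs from [1] at
    [th = 0] down to [a] at [th = pi]; its square is affine in [cos th]. *)
Definition interval_point th := (1 + a) / 2 * radius rho th.

Lemma ratio_gt0 : 0 < rho.
Proof. by rewrite divr_gt0 ?subr_gt0// addr_gt0. Qed.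

Lemma ratio_lt1 : rho < 1.
Proof. have a0 := a_gt0; rewrite ltr_pdivrMr ?addr_gt0//; lra. Qed.

Let rho_ge0 : 0 <= rho := ltW ratio_gt0.

Lemma interval_point_gt0 th : 0 < interval_point th.
Proof.
have a0 := a_gt0.
by rewrite mulr_gt0 ?radius_gt0 ?ratio_lt1// divr_gt0// addr_gt0.
Qed.

Lemma interval_point_sqr th :
  interval_point th ^+ 2 = (1 + a ^+ 2) / 2 + (1 - a ^+ 2) / 2 * cos th.
Proof.
have h : 1 + a != 0 by rewrite gt_eqF// addr_gt0.
rewrite exprMn radius2 ?ratio_lt1// /ratio; field; exact: h.
Qed.

Lemma interval_point_itv th : a <= interval_point th <= 1.
Proof.
have a0 := a_gt0; have a1 := a_lt1.
have p0 := interval_point_gt0 th; have psq := interval_point_sqr th.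
have := cos_le1 th; have := cos_geN1 th => c1 c2.
have h : 0 < 1 - a ^+ 2 by rewrite subr_gt0 expr_lt1// ltW.
apply/andP; split.
  rewrite -(@ler_pXn2r _ 2) ?nnegrE ?(ltW p0) ?(ltW a0)// psq.
  have : 0 <= (1 - a ^+ 2) * (1 + cos th) by rewrite mulr_ge0 ?(ltW h)//; lra.
  lra.
rewrite -(@ler_pXn2r _ 2) ?nnegrE ?(ltW p0)// psq expr1n.
have : 0 <= (1 - a ^+ 2) * (1 - cos th) by rewrite mulr_ge0 ?(ltW h)//; lra.
lra.
Qed.

Lemma interval_point_surj x : a <= x <= 1 -> exists th, x = interval_point th.
Proof.
have a0 := a_gt0; have a1 := a_lt1.
case/andP=> ax x1; have x0 : 0 < x by exact: lt_le_trans ax.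
have h : 0 < 1 - a ^+ 2 by rewrite subr_gt0 expr_lt1// ltW.
pose u := (2 * x ^+ 2 - (1 + a ^+ 2)) / (1 - a ^+ 2).
have x2a : a ^+ 2 <= x ^+ 2 by rewrite ler_pXn2r ?nnegrE ?(ltW a0) ?(ltW x0).
have x21 : x ^+ 2 <= 1 by rewrite expr_le1 ?(ltW x0).
have hu : -1 <= u <= 1.
  rewrite /u ler_pdivlMr// ler_pdivrMr//; apply/andP; split; lra.
exists (acos u); apply/eqP.
rewrite -(@eqrXn2 _ 2) ?(ltW x0) ?(ltW (interval_point_gt0 _))//; apply/eqP.
rewrite interval_point_sqr acosK ?in_itv//= /u; field; exact: lt0r_neq0.
Qed.

Lemma interval_point_lt s t : 0 <= s -> t <= pi -> s < t ->
  interval_point t < interval_point s.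
Proof.
move=> s0 tpi st.
have h : 0 < (1 - a ^+ 2) / 2.
  by rewrite divr_gt0// subr_gt0 expr_lt1// ltW.
rewrite -(@ltr_pXn2r _ 2) ?nnegrE ?(ltW (interval_point_gt0 _))//.
rewrite !interval_point_sqr ltrD2l ltr_pM2l//.
rewrite ltr_cos ?in_itv//=; first by rewrite s0 (le_trans (ltW st)).
by rewrite tpi (le_trans s0)// ltW.
Qed.

(** The recurrence of Chebyshev polynomials, in the variable [u] which is the
    affine function of [x ^ 2] equal to [cos th]. *)
Lemma cos_poly k : exists p : {poly R}, [/\ (size p <= (2 * k).+1)%N,
  forall x, p.[- x] = p.[x] & forall th, p.[interval_point th] = cos (k%:R * th)].
Proof.
suff [] : (exists p : {poly R}, [/\ (size p <= (2 * k).+1)%N,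
    forall x, p.[- x] = p.[x] & forall th, p.[interval_point th] = cos (k%:R * th)]) /\
  (exists p : {poly R}, [/\ (size p <= (2 * k.+1).+1)%N,
    forall x, p.[- x] = p.[x] & forall th, p.[interval_point th] = cos (k.+1%:R * th)]) by [].
have h : 1 - a ^+ 2 != 0.
  by rewrite gt_eqF// subr_gt0 expr_lt1// ltW.
pose u : {poly R} := (2 / (1 - a ^+ 2)) *: 'X^2 - ((1 + a ^+ 2) / (1 - a ^+ 2))%:P.
have us : (size u <= 3)%N.
  rewrite (leq_trans (size_polyD _ _))// geq_max size_polyN.
  by rewrite (leq_trans (size_scale_leq _ _)) ?size_polyXn// (leq_trans (size_polyC_leq1 _)).
have ue x : u.[x] = (2 * x ^+ 2 - (1 + a ^+ 2)) / (1 - a ^+ 2).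
  rewrite /u hornerD hornerN hornerZ hornerXn hornerC; by field.
have uN x : u.[- x] = u.[x] by rewrite !ue sqrrN.
have up th : u.[interval_point th] = cos th by rewrite ue interval_point_sqr; field.
clear ue; clearbody u.
elim: k => [|k [[p [sp pN pp]] [q [sq qN qp]]]].
  split; first by exists 1; split=> [|x|th]; rewrite ?size_poly1 ?hornerC ?mul0r ?cos0.
  by exists u; split=> // th; rewrite up mul1r.
split; first by exists q.
exists (2 *: (u * q) - p); split.
- rewrite (leq_trans (size_polyD _ _))// geq_max size_polyN; apply/andP; split.
    rewrite (leq_trans (size_scale_leq _ _))// (leq_trans (size_polyMleq _ _))//.
    have := leq_add us sq; move: (size u + size q)%N => A; lia.
  by rewrite (leq_trans sp)//; lia.
- by move=> x; rewrite !(hornerD, hornerN, hornerZ, hornerM) pN qN uN.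
- move=> th; rewrite hornerD hornerN hornerZ hornerM pp qp up.
  have -> : k.+2%:R * th = k.+1%:R * th + th by rewrite -natr1 mulrDl mul1r.
  have -> : k%:R * th = k.+1%:R * th - th by rewrite -natr1 mulrDl mul1r addrK.
  rewrite [cos (_ - th)]cosB cosD; ring.
Qed.

Lemma truncated_sum_poly m N : exists p : {poly R}, [/\ (size p <= 2 * m + 2)%N,
  forall x, p.[- x] = - p.[x] &
  forall th, p.[interval_point th] = radius rho th * truncated_sum rho m N th].
Proof.
have /choice[P hP] := cos_poly.
pose T : {poly R} := \sum_(i < N) \sum_(j < N | (i <= j + m)%N && (j <= i + m)%N)
   (cbin R i * cbin R j * (- rho) ^+ (i + j)) *: P (i - j + (j - i))%N.
have Ts : (size T <= (2 * m).+1)%N.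
  apply: (leq_trans (size_sum _ _ _)); apply/bigmax_leqP => i _.
  apply: (leq_trans (size_sum _ _ _)); apply/bigmax_leqP => j /andP[ij ji].
  rewrite (leq_trans (size_scale_leq _ _))//.
  have [sP _ _] := hP (i - j + (j - i))%N; rewrite (leq_trans sP)//; lia.
have TN x : T.[- x] = T.[x].
  rewrite !horner_sum; apply: eq_bigr => i _; rewrite !horner_sum.
  by apply: eq_bigr => j _; rewrite !hornerZ; have [_ -> _] := hP (i - j + (j - i))%N.
have Tp th : T.[interval_point th] = truncated_sum rho m N th.
  rewrite horner_sum; apply: eq_bigr => i _; rewrite horner_sum.
  apply: eq_bigr => j _; rewrite hornerZ.
  have [_ _ ->] := hP (i - j + (j - i))%N; rewrite -!mulrA; congr (_ * (_ * (_ * _))).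
  rewrite -mulrBl; have [ij|ji] := leqP i j.
    have -> : (i - j + (j - i) = j - i)%N by lia.
    by rewrite natrB// -cosN -mulNr opprB.
  have -> : (i - j + (j - i) = i - j)%N by lia.
  by rewrite natrB// ltnW.
have c0 : (1 + a) / 2 != 0 :> R by rewrite gt_eqF// divr_gt0// addr_gt0.
exists (((1 + a) / 2)^-1 *: ('X * T)); split.
- rewrite (leq_trans (size_scale_leq _ _))// (leq_trans (size_polyMleq _ _))//.
  by rewrite size_polyX; move: (size T) Ts => s; lia.
- by move=> x; rewrite !(hornerZ, hornerM, hornerX) TN; ring.
- move=> th; rewrite hornerZ hornerM hornerX Tp mulrA; congr (_ * _).
  by rewrite /point mulKf.
Qed.

End Main.

(** * Two-sided bounds and the limit *)

Section Bounds.
Variables (R : realType) (a : R).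
Hypotheses (a_gt0 : 0 < a) (a_lt1 : a < 1).
Local Notation rho := (ratio a).

(** The sum of the series of the [cbin R j * rho ^+ (2 * j)]. *)
Definition rho_factor := (Num.sqrt (1 - rho ^+ 2))^-1.
Local Notation S := rho_factor.

Definition amplitude m := 2 * cbin R m.+1 * S * rho ^+ m.+1.

(** The part of the error of the truncation that remains when the number of Taylor
    terms grows; relatively to the amplitude it is [O(1 / m)]. *)
Definition defect m := amplitude m * ((1 - rho) ^- 4 / m.+2%:R).

Let rho0 : 0 < rho := ratio_gt0 a_gt0 a_lt1.
Let rho1 : rho < 1 := ratio_lt1 a_gt0.

Lemma one_sub_ratio2 : 0 < 1 - rho ^+ 2 <= 1.
Proof.
by rewrite subr_gt0 expr_lt1 ?(ltW rho0)// rho1 gerBl exprn_ge0// ltW.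
Qed.

Lemma rho_factor_sqr : S ^+ 2 = (1 - rho ^+ 2)^-1.
Proof.
have /andP[h _] := one_sub_ratio2.
by rewrite exprVn sqr_sqrtr// ltW.
Qed.

Lemma rho_factor_ge1 : 1 <= S.
Proof.
have /andP[h0 h1] := one_sub_ratio2.
rewrite -[leLHS]invr1 lef_pV2 ?posrE ?sqrtr_gt0//.
by rewrite -[leRHS]sqrtr1 ler_wsqrtr.
Qed.

Lemma amplitude_gt0 m : 0 < amplitude m.
Proof.
by rewrite !mulr_gt0 ?cbin_gt0 ?exprn_gt0 ?(lt_le_trans ltr01 rho_factor_ge1).
Qed.

(** The error of this polynomial on [[a, 1]] almost equioscillates: it serves both as a
    competitor and as the reference of the alternation argument. *)
Lemma near_best_odd_poly m (e : R) : 0 < e -> exists p : {poly R},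
  [/\ (size p <= 2 * m + 2)%N,
  forall x, p.[- x] = - p.[x] &
  forall th, `|p.[interval_point a th] - 1
     + (-1) ^+ m.+1 * amplitude m * cos (phase rho m.+1 th)| <= defect m + e].
Proof.
move=> e0.
have d0 : 0 < 1 - rho by rewrite subr_gt0.
have [M hM] : exists M, 16 * rho ^+ M / (1 - rho) ^+ 2 <= e.
  have cv : rho ^+ M @[M --> \oo] --> (0 : R).
    by apply: cvg_expr; rewrite gtr0_norm.
  have e'0 : 0 < e * (1 - rho) ^+ 2 / 16 by rewrite !divr_gt0 ?mulr_gt0 ?exprn_gt0.
  have /cvgrPdist_le/(_ _ e'0)[M _ /(_ M (leqnn M)) /=] := cv.
  rewrite sub0r normrN ger0_norm ?exprn_ge0 ?(ltW rho0)// => h; exists M.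
  rewrite ler_pdivrMr ?exprn_gt0// mulrC -ler_pdivlMr//.
have [p [sp pN pp]] := truncated_sum_poly a_gt0 a_lt1 m (M + m.+1).
exists p; split=> // th; rewrite pp.
have -> : (-1) ^+ m.+1 * amplitude m = 2 * cbin R m.+1 * S * (- rho) ^+ m.+1.
  by rewrite (exprNn rho) /amplitude; ring.
have := truncated_sum_estimate (ltW rho0) rho1 m M th rho_factor_ge1 rho_factor_sqr.
move=> h; apply: (le_trans h); rewrite lerD// /defect /amplitude.
rewrite [leRHS](_ : _ = S * (2 * rho ^+ m.+1 * cbin R m.+1 / m.+2%:R * (1 - rho) ^- 4)).
  by rewrite ler_peMl ?rho_factor_ge1// !mulr_ge0 ?invr_ge0 ?exprn_ge0 ?ltW ?cbin_gt0.
by ring.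
Qed.

Lemma deviation_le_amplitude m (q : {poly R}) :
  best_approx a (2 * m + 1) q -> deviation a q <= amplitude m + defect m.
Proof.
move=> [_ hq]; apply/ler_addgt0Pr => e e0.
have [p [sp pN pp]] := near_best_odd_poly m e0.
have {sp} sp : (size p <= (2 * m + 1).+1)%N by rewrite -addnS.
apply: (le_trans (hq _ sp)); apply: (deviation_le a_gt0 a_lt1).
have pos x : a <= x <= 1 -> `|p.[x] - 1| <= amplitude m + defect m + e.
  move=> /(interval_point_surj a_gt0 a_lt1)[th ->].
  have := pp th; set c := _ * cos _ => h.
  have hc : `|c| <= amplitude m.
    rewrite /c normrM normrMsign (gtr0_norm (amplitude_gt0 m)).
    by rewrite ler_piMr ?cos_max// ltW// amplitude_gt0.
  by rewrite -[_ - 1](addrK c) (le_trans (ler_normB _ _))// [leLHS]addrC -[leRHS]addrA lerD.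
have a0 := a_gt0.
move=> x /X_setP[/andP[x1 x2]|/andP[x1 x2]].
  have := pos (- x); rewrite pN ltr0_sg; last lra.
  rewrite -opprD normrN opprK => -> //; lra.
rewrite gtr0_sg; last lra.
by apply: pos; rewrite x1.
Qed.

(** A comparison in the manner of de la Vallee Poussin.  If [q] did better, then at the
    alternation points of the near-best polynomial [p] the function
    [(q - p) x - (q - p) (- x)] would have the sign opposite to that of the error of [p]:
    an odd polynomial with too many roots. *)
Lemma deviation_ge_amplitude m (q : {poly R}) :
  (size q <= 2 * m + 2)%N -> amplitude m <= deviation a q + defect m.
Proof.
move=> sq; apply/ler_addgt0Pr => e e0; rewrite leNgt; apply/negP => hlt.
have [p [sp pN pp]] := near_best_odd_poly m e0.
have [t [ht tlt]] := phase_points (ltW rho0) rho1 (leqnn m.+1).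
pose y j := interval_point a (t j).
have y0 j : 0 < y j by exact: interval_point_gt0.
have yX j : X_set a (y j) by apply/X_setP; right; exact: interval_point_itv.
pose f : {poly R} := (-1) ^+ m.+1 *: ((q - p) - ((q - p) \Po (- 'X))).
have fE x : f.[x] = (-1) ^+ m.+1 * ((q.[x] - 1) - (q.[- x] + 1) - 2 * (p.[x] - 1)).
  rewrite /f hornerZ !(horner_comp, hornerD, hornerN, hornerX) pN.
  by congr (_ * _); ring.
have fN x : f.[- x] = - f.[x].
  by rewrite !fE pN opprK; ring.
have sf : (size f <= 2 * m + 2)%N.
  have sqp : (size (q - p)%R <= 2 * m + 2)%N.
    by rewrite (leq_trans (size_polyD _ _))// geq_max sq size_polyN.
  rewrite (leq_trans (size_scale_leq _ _))// (leq_trans (size_polyD _ _))//.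
  rewrite geq_max sqp size_polyN (leq_trans (size_comp_poly_leq _ _))//.
  rewrite size_polyN size_polyX /= muln1; move: (size _) sqp => s; lia.
have ylt i j : (i < j)%N -> (j <= m.+1)%N -> y j < y i.
  move=> ij jm; apply: (interval_point_lt a_gt0 a_lt1); last exact: tlt.
    by have [/andP[]] := ht i (leq_trans (ltnW ij) jm).
  by have [/andP[]] := ht j jm.
have fy j : (j <= m.+1)%N -> 0 < (-1) ^+ j * f.[y j].
  move=> jm; have [_ phj] := ht j jm.
  have := pp (t j); rewrite -/(y j) phj cos_natpi exprS => h.
  have h1 := deviation_ge a_gt0 a_lt1 q (yX j).
  have h2 := deviation_ge a_gt0 a_lt1 q (X_setN (yX j)).
  move: h1 h2; rewrite sgrN (gtr0_sg (y0 j)) opprK => h1 h2.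
  rewrite fE mulrA -exprD addnC.
  have {}h : `|p.[y j] - 1 + (-1) ^+ (m.+1 + j) * amplitude m| <= defect m + e.
    by move: h; rewrite -exprS mulrAC -exprD.
  move: h h1 h2; rewrite -(signr_odd _ (m.+1 + j)) !ler_norml.
  case: (odd _); rewrite ?expr0 ?expr1; lra.
have := odd_alternation fN (ltW (y0 _)) ylt fy; rewrite ltnNge mulnS addnC.
by rewrite sf.
Qed.

Lemma cvg_sqrt_cbin :
  Num.sqrt (m%:R : R) * cbin R m.+1 @[m --> \oo] --> (Num.sqrt pi)^-1.
Proof.
have p0 := pi_gt0 R.
have -> : (fun m : nat => Num.sqrt (m%:R : R) * cbin R m.+1) =
    (fun m => Num.sqrt (m%:R * cbin R m.+1 ^+ 2)).
  apply/funext => m.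
  by rewrite sqrtrM ?ler0n// sqrtr_sqr gtr0_norm// cbin_gt0.
rewrite -sqrtrV ?(ltW p0)//.
apply: (@continuous_cvg _ R R _ _ (fun m => m%:R * cbin R m.+1 ^+ 2) Num.sqrt pi^-1);
  first exact: sqrt_continuous.
apply: (@squeeze_cvgr _ _ _ _ (fun m => pi^-1 * (1 - 3 * harmonic m)) (fun=> pi^-1)).
- apply: nearW => m.
  have /andP[h1 h2] := cbin_wallis R (ltn0Sn m).
  have m1 : 0 < m.+1%:R :> R by rewrite ltr0n.
  have m0 : 0 <= m%:R :> R by rewrite ler0n.
  apply/andP; split.
    apply: le_trans (ler_wpM2l m0 h1).
    rewrite /harmonic /= invfM mulrA mulrA [leLHS]mulrC ler_pM2r ?invr_gt0//.
    have -> : m.+1.*2.+1%:R = 2 * m%:R + 3 :> R.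
      by rewrite -natr1 -muln2 natrM -natr1; ring.
    rewrite -[m.+1%:R]natr1; move: (m%:R : R) m0 => x x0.
    have x1 : 0 < x + 1 by lra.
    have x3 : 0 < 2 * x + 3 by lra.
    rewrite -subr_ge0.
    have -> : x * 2 / (2 * x + 3) - (1 - 3 / (x + 1)) =
        (3 * x + 6) / ((2 * x + 3) * (x + 1)).
      by field; rewrite !lt0r_neq0.
    by rewrite divr_ge0// ?mulr_ge0 ?(ltW x1) ?(ltW x3)//; lra.
  apply: le_trans (ler_wpM2l m0 h2) _.
  rewrite invfM mulrA ler_piMl ?invr_ge0 ?(ltW p0)// ler_pdivrMr// mul1r ler_nat.
  exact: leqnSn.
- rewrite -[X in _ --> X]mulr1; apply: cvgM; first exact: cvg_cst.
  rewrite -[X in _ --> X]subr0; apply: cvgB; first exact: cvg_cst.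
  rewrite -[X in _ --> X](mulr0 3); apply: cvgM; first exact: cvg_cst.
  exact: cvg_harmonic.
- exact: cvg_cst.
Qed.

Lemma limit_constantE : 2 * S * rho / Num.sqrt pi = (1 - a) / Num.sqrt (pi * a).
Proof.
have a0 := a_gt0; have a1 := a_lt1; have p0 := pi_gt0 R.
have sa : 0 < Num.sqrt a by rewrite sqrtr_gt0.
have sp : 0 < Num.sqrt (pi : R) by rewrite sqrtr_gt0.
have -> : S = (1 + a) / (2 * Num.sqrt a).
  rewrite /rho_factor -[RHS]invf_div; congr (_^-1).
  have -> : 1 - rho ^+ 2 = (2 * Num.sqrt a / (1 + a)) ^+ 2.
    rewrite !exprMn sqr_sqrtr ?(ltW a0)// /ratio; field.
    by rewrite gt_eqF//; lra.
  by rewrite sqrtr_sqr ger0_norm// divr_ge0// ?mulr_ge0 ?(ltW sa)//; lra.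
rewrite sqrtrM ?(ltW p0)// /ratio.
move: (Num.sqrt a) (Num.sqrt pi) sa sp => s p s0 q0.
by field; rewrite !gt_eqF//; lra.
Qed.

(** Multiplied by the normalization, the amplitude is a constant times
    [sqrt m * cbin m.+1], and the two bounds differ from it by a factor
    [1 + O(1 / m)]. *)
Lemma deviation_cvg (p : nat -> {poly R}) :
  (forall m : nat, (0 < m)%N -> best_approx a (2 * m + 1)%N (p m)) ->
  Num.sqrt m%:R * ((1 + a) / (1 - a)) ^+ m * deviation a (p m)
    @[m --> \oo] --> (1 - a) / Num.sqrt (pi * a).
Proof.
move=> hp; rewrite -limit_constantE.
pose K := (1 - rho) ^- 4.
pose g m := 2 * S * rho * (Num.sqrt m%:R * cbin R m.+1).
have K0 : 0 <= K by rewrite invr_ge0 exprn_ge0// subr_ge0 ltW.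
have S0 : 0 < S := lt_le_trans ltr01 rho_factor_ge1.
have g0 m : 0 <= g m.
  have c0 : 0 <= 2 * S * rho by rewrite ltW// mulr_gt0// mulr_gt0.
  by rewrite mulr_ge0// mulr_ge0 ?sqrtr_ge0// ltW// cbin_gt0.
have cvg_g : g m @[m --> \oo] --> 2 * S * rho / Num.sqrt pi.
  by apply: cvgM; [exact: cvg_cst | exact: cvg_sqrt_cbin].
have ratioV : (1 + a) / (1 - a) = rho^-1 by rewrite invf_div.
have gE m : Num.sqrt m%:R * ((1 + a) / (1 - a)) ^+ m * amplitude m = g m.
  have r0 : rho ^+ m != 0 by rewrite expf_neq0// gt_eqF.
  rewrite ratioV exprVn /amplitude exprS /g.
  by move: (rho ^+ m) r0 => x x0; field.
have hK m : K / m.+2%:R <= K * harmonic m.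
  rewrite ler_wpM2l// /harmonic /= lef_pV2 ?posrE ?ltr0n// ler_nat; exact: leqnSn.
have cvg_c (s : R) : g m * (1 + s * (K * harmonic m)) @[m --> \oo]
    --> 2 * S * rho / Num.sqrt pi.
  rewrite -[X in _ --> X]mulr1; apply: cvgM => //.
  rewrite -[X in _ --> X]addr0; apply: cvgD; first exact: cvg_cst.
  rewrite -[X in _ --> X](mulr0 s); apply: cvgM; first exact: cvg_cst.
  rewrite -[X in _ --> X](mulr0 K); apply: cvgM; first exact: cvg_cst.
  exact: cvg_harmonic.
apply: (@squeeze_cvgr _ _ _ _ (fun m => g m * (1 + (-1) * (K * harmonic m)))
  (fun m => g m * (1 + 1 * (K * harmonic m)))); [|exact: cvg_c|exact: cvg_c].
near=> m.
have m0 : (0 < m)%N by near: m; exact: nbhs_infty_gt.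
have bp := hp m m0.
have up := deviation_le_amplitude bp.
have lo : amplitude m <= deviation a (p m) + defect m.
  by apply: deviation_ge_amplitude; rewrite (leq_trans bp.1)// -addnS.
set c := Num.sqrt m%:R * _.
have c0 : 0 <= c.
  by rewrite mulr_ge0 ?sqrtr_ge0// ratioV exprn_ge0// invr_ge0 ltW.
have cd : c * defect m <= g m * (K * harmonic m).
  by rewrite /defect mulrA gE ler_wpM2l.
have cg : c * amplitude m = g m := gE m.
have h1 := ler_wpM2l c0 up; have h2 := ler_wpM2l c0 lo.
move: h1 h2; rewrite !mulrDr cg mulN1r mul1r mulr1 mulrN.
lra.
Unshelve. all: by end_near.
Qed.

End Bounds.

Theorem theorem1 (R : realType) (a : R) (a_gt0 : 0 < a) (a_lt1 : a < 1) :
  (forall m : nat, (0 < m)%N ->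
     exists! p : {poly R}, best_approx a (2 * m + 1)%N p) /\
  (forall p : nat -> {poly R},
     (forall m : nat, (0 < m)%N -> best_approx a (2 * m + 1)%N (p m)) ->
     Num.sqrt m%:R * ((1 + a) / (1 - a)) ^+ m * deviation a (p m)
       @[m --> \oo] --> (1 - a) / Num.sqrt (pi * a)).
Proof.
split; last exact: deviation_cvg.
move=> m _; have [p hp] := best_approx_exists a_gt0 a_lt1 (2 * m + 1).
exists p; split=> // q hq; exact: (best_approx_unique a_gt0 a_lt1 hp hq).
Qed.
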